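(* Assume the Continuum Hypothesis. Then there exists an $\omega^\omega$-ultrafilter $\mathcal U$ on $\omega$ whose only RK-predecessor, up to RK-equivalence, is a Ramsey ultrafilter. That is: there is a Ramsey ultrafilter $\mathcal V$ with $\mathcal V \le_{RK} \mathcal U$ and $\mathcal V \not\equiv_{RK} \mathcal U$, and every nonprincipal ultrafilter $\mathcal W$ on $\omega$ with $\mathcal W \le_{RK} \mathcal U$ is RK-equivalent either to $\mathcal U$ or to $\mathcal V$.
   Context: All ultrafilters are on $\omega$. For $f:\omega\to\omega$ and an ultrafilter $\mathcal V$, $f(\mathcal V)=\{A\subseteq\omega: f^{-1}(A)\in\mathcal V\}$. We write $\mathcal W\le_{RK}\mathcal U$ if $\mathcal W=f(\mathcal U)$ for some $f:\omega\to\omega$, and $\mathcal W\equiv_{RK}\mathcal U$ if both $\mathcal W\le_{RK}\mathcal U$ and $\mathcal U\le_{RK}\mathcal W$. A nonprincipal ultrafilter $\mathcal U$ is Ramsey if for every $k,\ell\in\omega$ and every $c:[\omega]^k\to\ell$ there is $X\in\mathcal U$ homogeneous for $c$. For an ordinal $\alpha\le\omega_1$, a nonprincipal ultrafilter $\mathcal U$ is an $\alpha$-ultrafilter if $\alpha$ is the smallest ordinal such that for every $h:\omega\to\omega_1$ there is $X\in\mathcal U$ such that $h''X=\{h(n):n\in X\}$ has order type at most $\alpha$. Ordinal exponentiation is meant. *)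

(* Defs.v *)
From HB Require Import structures.
From mathcomp Require Import all_boot finmap.
From mathcomp Require Import boolp classical_sets functions cardinality wochoice filter.

Set Implicit Arguments.
Unset Strict Implicit.
Unset Printing Implicit Defensive.

Local Open Scope classical_set_scope.

(* Ordinals are represented by well-ordered types, each one standing for its
   order type; [wo_le] below is the order on ordinals. *)
Record wellOrder := WellOrder {
  wo_sort :> eqType;
  wo_rel : rel wo_sort;
  wo_relP : well_order wo_rel }.

Definition wo_lt (A : wellOrder) (x y : A) : bool := ~~ wo_rel y x.

(* A <= B: A is isomorphic to an initial segment of B. *)
Definition wo_le (A B : wellOrder) : Prop :=
  exists f : A -> B,
    (forall x y, wo_rel (f x) (f y) = wo_rel x y) /\
    (forall x b, wo_rel b (f x) -> exists y, f y = b).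

Section WellOrderTheory.
Variable A : wellOrder.
Implicit Types x y z : A.

Lemma wo_total : total (@wo_rel A).
Proof.
move=> x y; have := @wo_relP A; rewrite /well_order => wo.
case: (wo [pred z | (z == x) || (z == y)]).
  by exists x; rewrite inE eqxx.
move=> z [[+ lb] _]; rewrite inE => /orP[] /eqP zE.
  by rewrite -zE lb // inE eqxx orbT.
by rewrite -zE orbC lb // inE eqxx.
Qed.

Lemma wo_refl : reflexive (@wo_rel A).
Proof. by move=> x; have := wo_total x x; rewrite orbb. Qed.

Lemma wo_anti : antisymmetric (@wo_rel A).
Proof.
move=> x y /andP[xy yx].
case: (@wo_relP A [pred z | (z == x) || (z == y)]).
  by exists x; rewrite inE eqxx.
move=> z [_ uz]; rewrite -(uz x) ?(uz y) //; split; rewrite ?inE ?eqxx ?orbT //.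
- by move=> t; rewrite inE => /orP[] /eqP ->; rewrite // wo_refl.
- by move=> t; rewrite inE => /orP[] /eqP ->; rewrite // wo_refl.
Qed.

Lemma wo_trans : transitive (@wo_rel A).
Proof.
move=> y x z xy yz.
case: (@wo_relP A [pred t | [|| t == x, t == y | t == z]]).
  by exists x; rewrite inE eqxx.
move=> t [[+ lb] _]; rewrite inE => /or3P[] /eqP tE; subst t.
- by apply: lb; rewrite inE eqxx !orbT.
- have yx : wo_rel y x by apply: lb; rewrite inE eqxx.
  by rewrite (@wo_anti x y) // xy yx.
- have zy : wo_rel z y by apply: lb; rewrite inE eqxx orbT.
  by rewrite -(@wo_anti y z) // yz zy.
Qed.

Lemma wo_ltW x y : wo_lt x y -> wo_rel x y.
Proof. by have /orP[//|yx] := wo_total x y; rewrite /wo_lt yx. Qed.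

Lemma wo_ltxx x : wo_lt x x = false.
Proof. by rewrite /wo_lt wo_refl. Qed.

Lemma wo_lt_le_trans y x z : wo_lt x y -> wo_rel y z -> wo_lt x z.
Proof. by move=> /negP xy yz; apply/negP => zx; apply/xy/(wo_trans yz zx). Qed.

Lemma wo_le_lt_trans y x z : wo_rel x y -> wo_lt y z -> wo_lt x z.
Proof. by move=> xy /negP yz; apply/negP => zx; apply/yz/(wo_trans zx xy). Qed.

Lemma wo_lt_trans y x z : wo_lt x y -> wo_lt y z -> wo_lt x z.
Proof. by move=> xy /wo_ltW; apply: wo_lt_le_trans. Qed.

Lemma wo_ltP x y : [\/ x = y, wo_lt x y | wo_lt y x].
Proof.
have [yx|xy] := boolP (wo_rel y x); last by constructor 2.
have [xy|?] := boolP (wo_rel x y); last by constructor 3.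
by constructor 1; apply: wo_anti; rewrite xy yx.
Qed.

Lemma wo_min (P : set A) : P !=set0 -> exists2 x, P x & forall y, P y -> wo_rel x y.
Proof.
move=> [x Px]; case: (@wo_relP A (fun z => `[< P z >])).
  by exists x; exact/asboolP.
move=> z [[/asboolP Pz lb] _]; exists z => // y Py.
by apply: lb; exact/asboolP.
Qed.

Lemma wo_lt_wf : well_founded (@wo_lt A).
Proof.
move=> x; apply: contrapT => nAx.
have [y nAy ymin] := wo_min (ex_intro (fun y => ~ Acc (@wo_lt A) y) x nAx).
apply: nAy; constructor => z /negP zy; apply: contrapT => /ymin; exact: zy.
Qed.

End WellOrderTheory.

Lemma well_order_wf (T : eqType) (le : rel T) :
  antisymmetric le -> total le -> well_founded (fun x y => ~~ le y x) ->
  well_order le.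
Proof.
move=> anti tot wf; apply: antisymmetric_well_order => // P [x Px].
elim/(well_founded_ind wf): x Px => x IH Px.
have [[y Py xy]|h] := pselect (exists2 y, y \in P & ~~ le x y).
  exact: IH xy Py.
exists x; split=> // y Py; apply: contrapT => /negP xy.
by apply: h; exists y.
Qed.

Definition suborder_rel (A : wellOrder) (S : set A) : rel S :=
  fun x y => wo_rel (val x) (val y).

Lemma suborder_relP (A : wellOrder) (S : set A) : well_order (@suborder_rel A S).
Proof.
apply: well_order_wf.
- by move=> x y /wo_anti /val_inj.
- by move=> x y; apply: wo_total.
- move=> x; have := erefl (val x); move: {2}(val x) => a.
  elim/(well_founded_ind (@wo_lt_wf A)): a x => a IH x xa.
  by constructor => y yx; apply: (IH (val y)) => //; rewrite -xa.
Qed.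

(* The order type of a set S of elements of A. *)
Definition suborder (A : wellOrder) (S : set A) : wellOrder :=
  WellOrder (@suborder_relP A S).

Lemma leq_well_order : well_order leq.
Proof.
apply: well_order_wf.
- exact: anti_leq.
- exact: leq_total.
- move=> n; elim/ltn_ind: n => n IH; constructor => m; rewrite -ltnNge; exact: IH.
Qed.

Definition omega : wellOrder := WellOrder leq_well_order.


Lemma finite_wo_max (A : wellOrder) (S : set A) :
  finite_set S -> S !=set0 -> exists2 x, S x & forall y, S y -> wo_rel y x.
Proof.
move=> /finite_seqP[s ->{S}]; elim: s => [[x]//|x [_ _|y s IH _]].
  by exists x; rewrite /= ?mem_head// => z /[!inE] /eqP ->; exact: wo_refl.
have [|m ms mM] := IH; first by exists y; rewrite /= mem_head.
have [xm|mx] := orP (wo_total x m).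
  exists m => [|z]; first by rewrite /= in_cons ms orbT.
  by rewrite /= in_cons => /predU1P[->//|]; exact: mM.
exists x => [|z]; first by rewrite /= mem_head.
rewrite /= in_cons => /predU1P[->|/mM zm]; first exact: wo_refl.
exact: wo_trans zm mx.
Qed.

(* Ordinal exponentiation A ^ B: the finitely supported functions from B to A,
   compared at the largest argument where they differ.  An argument is in the
   support when the value there is not the least element of A. *)
Section Exponentiation.
Variables A B : wellOrder.
Implicit Types f g h : B -> A.

Definition exp_supp f : set B := [set b | exists a, wo_lt a (f b)].

Definition exp_fun : set (B -> A) := [set f | finite_set (exp_supp f)].

Definition exp_lt f g : Prop :=
  exists b, wo_lt (f b) (g b) /\ forall c, wo_lt b c -> f c = g c.

Definition exp_rel : rel exp_fun :=
  fun f g : exp_fun => `[< f = g \/ exp_lt (val f) (val g) >].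

Lemma exp_trichotomy (f g : exp_fun) :
  [\/ f = g, exp_lt (val f) (val g) | exp_lt (val g) (val f)].
Proof.
have [->|fg] := pselect (f = g); first exact: Or31.
pose D := [set b | val f b <> val g b].
have finD : finite_set D.
  apply: (@sub_finite_set _ _ (exp_supp (val f) `|` exp_supp (val g))).
    move=> b /= nfg; have [//|lt|lt] := wo_ltP (val f b) (val g b).
    - by right; exists (val f b).
    - by left; exists (val g b).
  rewrite finite_setU; split.
  - by have /set_mem := valP f.
  - by have /set_mem := valP g.
have D0 : D !=set0.
  apply: contrapT => nD; apply/fg/val_inj/funext => b.
  by apply: contrapT => ?; apply: nD; exists b.
have [b Db bmax] := finite_wo_max finD D0.
have above c : wo_lt b c -> val f c = val g c.
  by move=> /negP bc; apply: contrapT => /bmax; exact: bc.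
have [/Db//|lt|lt] := wo_ltP (val f b) (val g b).
- by apply: Or32; exists b.
- by apply: Or33; exists b; split=> // c /above.
Qed.

Lemma exp_lt_irr f : ~ exp_lt f f.
Proof. by move=> [b []]; rewrite wo_ltxx. Qed.

Lemma exp_lt_trans f g h : exp_lt f g -> exp_lt g h -> exp_lt f h.
Proof.
move=> [b [fgb fg]] [c [ghc gh]]; have [bc|bc|cb] := wo_ltP b c.
- subst c; exists b; split; first exact: wo_lt_trans ghc.
  by move=> d bd; rewrite fg // gh.
- exists c; split; first by rewrite fg.
  by move=> d cd; rewrite fg ?gh //; exact: wo_lt_trans cd.
- exists b; split; first by rewrite -gh.
  by move=> d bd; rewrite fg ?gh //; exact: wo_lt_trans bd.
Qed.

Lemma exp_lt_wf : well_founded (fun f g : exp_fun => exp_lt (val f) (val g)).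
Proof.
set R := (fun f g : exp_fun => _).
have finS (f : exp_fun) : finite_set (exp_supp (val f)) by have /set_mem := valP f.
have step c :
    (forall f : exp_fun, (forall d, exp_supp (val f) d -> wo_lt d c) -> Acc R f) ->
    forall f : exp_fun, (forall d, exp_supp (val f) d -> wo_rel d c) -> Acc R f.
  move=> IH f fc.
  have [m _ mmin] : exists2 m : A, setT m & forall a, setT a -> wo_rel m a.
    by apply: wo_min; exists (val f c).
  pose restf (g : B -> A) := fun d => if d == c then m else g d.
  have restP (g : exp_fun) : restf (val g) \in exp_fun.
    apply/mem_set; apply: (@sub_finite_set _ _ (exp_supp (val g))); last exact: finS.
    move=> d [a]; rewrite /restf; case: eqP => _ ad; last by exists a.
    by move: ad; rewrite /wo_lt mmin.
  pose rest (g : exp_fun) : exp_fun := exist _ (restf (val g)) (restP g).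
  have restAcc (g : exp_fun) :
      (forall d, exp_supp (val g) d -> wo_rel d c) -> Acc R (rest g).
    move=> gc; apply: IH => d [a] /=; rewrite /restf.
    case: eqP => [_|dc ad]; first by rewrite /wo_lt mmin.
    have dlec : wo_rel d c by apply: gc; exists a.
    by apply/negP => cd; apply/dc/wo_anti; rewrite dlec cd.
  suff claim a r : Acc R r ->
      forall g : exp_fun, rest g = r -> val g c = a ->
      (forall d, exp_supp (val g) d -> wo_rel d c) -> Acc R g.
    exact: (claim (val f c) (rest f) (restAcc f fc)).
  elim/(well_founded_ind (@wo_lt_wf A)): a r => a IHa r.
  elim=> {}r _ IHr g gr ga gc; constructor => h [d [hd dh]].
  have dc : wo_rel d c by apply: gc; exists (val h d).
  have hc e : exp_supp (val h) e -> wo_rel e c.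
    move=> he; apply: contrapT => /negP ce.
    have ge : exp_supp (val g) e.
      by move: he; rewrite /exp_supp /= dh //; exact: wo_le_lt_trans ce.
    by move: ce; rewrite gc.
  have [dec|{}dc] := eqVneq d c.
    apply: (IHa (val h c) _ (rest h) (restAcc h hc)) => //.
    by rewrite -ga -dec.
  have dltc : wo_lt d c.
    apply/negP => cd; move/eqP: dc; apply; apply: wo_anti.
    by rewrite cd gc //; exists (val h d).
  apply: (IHr (rest h)) => //; last by rewrite dh.
  rewrite -gr; exists d => /=; rewrite /restf (negbTE dc); split=> // e de.
  by case: eqP => // _; exact: dh.
have max (f : exp_fun) : Acc R f \/
    exists2 c, exp_supp (val f) c & forall d, exp_supp (val f) d -> wo_rel d c.
  have [f0|/set0P f0] := eqVneq (exp_supp (val f)) set0; last first.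
    by right; exact: finite_wo_max.
  left; constructor => h [c [hc _]].
  have : exp_supp (val f) c by exists (val h c).
  by rewrite f0.
have below b : forall f : exp_fun,
    (forall c, exp_supp (val f) c -> wo_lt c b) -> Acc R f.
  elim/(well_founded_ind (@wo_lt_wf B)): b => b IH f fb.
  have [//|[c fc]] := max f; apply: step; exact: IH (fb c fc).
by move=> f; have [//|[c _]] := max f; apply: step; exact: below.
Qed.

Lemma exp_relP : well_order exp_rel.
Proof.
apply: well_order_wf.
- move=> f g /andP[/asboolP[//|fg] /asboolP[//|gf]].
  by have /exp_lt_irr := exp_lt_trans fg gf.
- move=> f g; apply/orP; have [->|fg|gf] := exp_trichotomy f g.
  + by left; apply/asboolP; left.
  + by left; apply/asboolP; right.
  + by right; apply/asboolP; right.
- move=> f; elim: (exp_lt_wf f) => {}f _ IH; constructor => g /asboolP gf.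
  apply: IH; have [E|//|lt] := exp_trichotomy g f; case: gf; [left|right] => //.
Qed.

Definition wo_exp : wellOrder := WellOrder exp_relP.

End Exponentiation.

Definition powerset_order : wellOrder :=
  WellOrder (svalP (well_ordering_principle (set nat))).

(* The points with only countably many predecessors in a well-ordering of an
   uncountable set form a well-order of type omega_1: see [omega1_uncountable]
   and [omega1_segment]. *)
Definition omega1 : wellOrder :=
  @suborder powerset_order [set x | countable [set y | wo_lt y x]].

Local Open Scope card_scope.

Lemma omega1_segment (x : omega1) : countable [set y : omega1 | wo_lt y x].
Proof.
have /set_mem/countable_injP[f finj] := valP x.
apply/countable_injP; exists (f \o val) => y z /set_mem yx /set_mem zx /= E.
by apply/val_inj/finj => //; exact/mem_set.
Qed.

Lemma omega1_uncountable : ~ countable [set: omega1].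
Proof.
move=> /countable_injP[f finj].
pose C : set powerset_order := [set x | countable [set y | wo_lt y x]].
have Cval (y : powerset_order) : C y -> {z : omega1 | val z = y}.
  by move=> Cy; exists (exist _ y (mem_set Cy)).
have countC (D : set powerset_order) : D `<=` C -> countable D.
  move=> DC; apply/countable_injP.
  exists (fun y => if pselect (C y) is left Cy then f (sval (Cval y Cy)) else 0).
  move=> y z /set_mem/DC Cy /set_mem/DC Cz.
  case: pselect => // {}Cy; case: pselect => // {}Cz.
  by move=> /finj; rewrite !inE => /(_ I I) E;
     rewrite -(svalP (Cval y Cy)) E (svalP (Cval z Cz)).
have CT x : C x.
  apply: contrapT => nCx.
  have [m nCm mmin] := wo_min (ex_intro (fun x => ~ C x) x nCx).
  apply/nCm/countC => y /negP ym; apply: contrapT => /mmin; exact: ym.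
have /countable_injP[g ginj] : countable [set: powerset_order] by apply: countC.
pose d : set nat := [set n | exists2 S : set nat, g S = n & ~ S n].
have dE : d (g d) <-> ~ d (g d).
  split=> [[S /ginj SE nS]|nd]; last by exists d.
  by rewrite -{1}SE ?inE.
have nd : ~ d (g d) by move=> dg; exact: (dE.1 dg dg).
exact: nd (dE.2 nd).
Qed.

(* 2 ^ aleph_0 = aleph_1 *)
Definition continuum_hypothesis : Prop := [set: set nat] #= [set: omega1].

Definition nonprincipal (U : set_system nat) : Prop :=
  forall n, U <> principal_filter n.

Definition RK_le (W U : set_system nat) : Prop :=
  exists f : nat -> nat, W = fmap f U.

Definition RK_equiv (W U : set_system nat) : Prop := RK_le W U /\ RK_le U W.

(* [omega]^k *)
Definition ksubset (k : nat) := {s : {fset nat} | #|` s| == k}.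

Definition homogeneous (k l : nat) (c : ksubset k -> 'I_l) (X : set nat) : Prop :=
  forall s t : ksubset k,
    [set` val s] `<=` X -> [set` val t] `<=` X -> c s = c t.

Definition ramsey (U : set_system nat) : Prop :=
  [/\ UltraFilter U, nonprincipal U &
      forall (k l : nat) (c : ksubset k -> 'I_l),
        exists2 X, U X & homogeneous c X].

Definition small_images (alpha : wellOrder) (U : set_system nat) : Prop :=
  forall h : nat -> omega1,
    exists2 X, U X & wo_le (suborder (h @` X)) alpha.

(* The bound alpha <= omega1 needs no separate clause: [small_images omega1 U]
   always holds, so the minimality clause implies it. *)
Definition ordinal_ultrafilter (alpha : wellOrder) (U : set_system nat) : Prop :=
  [/\ UltraFilter U, nonprincipal U, small_images alpha U &
      forall beta : wellOrder, small_images beta U -> wo_le alpha beta].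

(* Main.v *)
Require Import Defs.
From mathcomp Require Import all_boot finmap.
From mathcomp Require Import boolp classical_sets functions cardinality wochoice filter.

(* On a copy N of the ordinal omega^omega with underlying set nat, call a set
   thin of rank k when its order type is below omega^k, and positive when it is
   not thin of any rank.  Every point x has a level, the least k for which the
   points below x form a thin set of rank k; a positive set meets the levels in
   pieces of unbounded rank.

   Modulo non-positive sets, decreasing omega-sequences of positive sets have
   positive pseudo-intersections.  The following requirements are dense: a
   function on N becomes constant, injective, or equivalent to the level map;
   the image of a function into omega_1 gets order type at most omega^omega; a
   colouring of k-sets of levels becomes homogeneous.  Under CH a tower of length
   omega_1 meets all of them and generates an ultrafilter U.  Its image V under
   the level map is Ramsey, and by the first requirement it is the only proper
   nonprincipal RK-predecessor.  Since all sets of U are positive, an embedding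
   of N into omega_1 has no image of type below omega^omega. *)

Set Implicit Arguments.
Unset Strict Implicit.
Unset Printing Implicit Defensive.

Local Open Scope classical_set_scope.

(** * Order types below powers of omega *)

(** Only the proper initial segments of the generator [Y] must lie in [J], not [Y] itself. Admitting
    every [Z] inside the union builds closure under subsets into the generation. *)
Inductive seg_generated (A : wellOrder) (J : set (set A)) : set A -> Prop :=
| SegGenerated0 : seg_generated J set0
| SegGeneratedU X Y Z : seg_generated J X ->
    (forall y, Y y -> J (Y `&` [set z | wo_lt z y])) -> Z `<=` X `|` Y ->
    seg_generated J Z.

(* [thin k X]: the order type of [X] is less than omega ^ k.  The sets all of
   whose proper initial segments are [thin k] have order type at most
   omega ^ k, and finite unions of these are the sets of type < omega ^ k.+1. *)
Fixpoint thin (A : wellOrder) (k : nat) : set (set A) :=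
  if k is k'.+1 then seg_generated (@thin A k') else [set set0].

Section ThinTheory.
Variable A : wellOrder.
Implicit Types (X Y Z : set A) (x y z : A) (k m n : nat).

Lemma thin0 k : thin k (@set0 A).
Proof. by case: k => [|k] //=; exact: SegGenerated0. Qed.

Lemma thinS k X Y : X `<=` Y -> thin k Y -> thin k X.
Proof.
case: k => [|k] /= XY; first by move=> Y0; rewrite Y0 subset0 in XY.
move=> tY; case: tY XY => [|Z1 Z2 Z gZ1 sZ2 ZU] XY.
  by move: XY; rewrite subset0 => ->; exact: SegGenerated0.
exact: (SegGeneratedU gZ1 sZ2 (subset_trans XY ZU)).
Qed.

Lemma thinU k X Y : thin k X -> thin k Y -> thin k (X `|` Y).
Proof.
case: k => [|k] /= tX; first by rewrite tX => ->; rewrite setU0.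
elim=> [|Y1 Y2 Z _ IH sY2 ZU]; first by rewrite setU0.
apply: (SegGeneratedU IH sY2) => x [Xx|/ZU[Y1x|Y2x]].
- by left; left.
- by left; right.
- by right.
Qed.

Lemma thin_segments k X :
  (forall y, X y -> thin k (X `&` [set z | wo_lt z y])) -> thin k.+1 X.
Proof.
move=> sX; apply: (SegGeneratedU (SegGenerated0 _) sX) => x Xx.
by right.
Qed.

Lemma thin_succ k X : thin k X -> thin k.+1 X.
Proof. by move=> tX; apply: thin_segments => y _; apply: thinS tX => x []. Qed.

Lemma thin_leq m n X : m <= n -> thin m X -> thin n X.
Proof.
move=> /subnKC <-; elim: (n - m) => [|d IH] tX; rewrite ?addn0 // addnS.
exact/thin_succ/IH.
Qed.

Lemma thin1 x : thin 1 [set x].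
Proof.
apply: thin_segments => y -> /=; rewrite -subset0 => z [] /= ->.
by rewrite wo_ltxx.
Qed.

Lemma thin_bigU k (I : eqType) (s : seq I) (F : I -> set A) :
  (forall i, i \in s -> thin k (F i)) ->
  thin k [set x | exists2 i, i \in s & F i x].
Proof.
elim: s => [|j s IH] tF; first by apply: (thinS _ (thin0 k)) => x [].
have tFs i : i \in s -> thin k (F i) by move=> si; apply: tF; rewrite in_cons si orbT.
apply: (thinS _ (thinU (IH tFs) (tF j (mem_head j s)))) => x [i].
by rewrite in_cons => /predU1P[->|si] Fx; [right|left; exists i].
Qed.

Lemma thin1_finite X : thin 1 X -> finite_set X.
Proof.
elim=> [|X1 Y Z _ fX sY ZU]; first exact: finite_set0.
apply: sub_finite_set ZU _; rewrite finite_setU; split=> //.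
have [[y Yy]|nY] := pselect (Y !=set0); last first.
  by apply: (sub_finite_set _ (@finite_set0 A)) => z Yz; apply: nY; exists z.
apply: (sub_finite_set _ (finite_set1 y)) => z Yz /=.
have [//|lt|lt] := wo_ltP z y.
- by have : (Y `&` [set t | wo_lt t y]) z by []; rewrite (sY y Yy).
- by have : (Y `&` [set t | wo_lt t z]) y by []; rewrite (sY z Yz).
Qed.

Definition increasing_blocks (B : nat -> set A) : Prop :=
  forall i j x y, i < j -> B i x -> B j y -> wo_lt x y.

Lemma thick_split k X : ~ thin k.+1 X ->
  exists x, ~ thin k (X `&` [set z | wo_lt z x]) /\
            ~ thin k.+1 (X `\` [set z | wo_lt z x]).
Proof.
move=> nX; have [x [Xx nx] xmin] : exists2 x,
    (X x /\ ~ thin k (X `&` [set z | wo_lt z x])) &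
    forall y, X y /\ ~ thin k (X `&` [set z | wo_lt z y]) -> wo_rel x y.
  apply: wo_min; apply: contrapT => no; apply/nX/thin_segments => y Xy.
  by apply: contrapT => ny; apply: no; exists y.
exists x; split=> // tX; apply: nX.
rewrite -(setUIDK X [set z | wo_lt z x]); apply: thinU tX.
apply: thin_segments => y [Xy /= yx]; apply: contrapT => ny.
move: (yx); rewrite /wo_lt xmin //; split=> // ty; apply: ny.
by apply: thinS ty => z [[]].
Qed.

(** Cut the remainder again and again with [thick_split]; the blocks are the pieces cut off. *)
Lemma thick_blocks k X : ~ thin k.+1 X ->
  exists B : nat -> set A, [/\ forall i, B i `<=` X,
    forall i, ~ thin k (B i) & increasing_blocks B].
Proof.
move=> nX; have [x0 _] := thick_split nX.
have /choice[f fP] : forall Y : set A, exists x, ~ thin k.+1 Y ->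
    ~ thin k (Y `&` [set z | wo_lt z x]) /\
    ~ thin k.+1 (Y `\` [set z | wo_lt z x]).
  move=> Y; have [|/thick_split[x]] := pselect (thin k.+1 Y); first by exists x0.
  by exists x.
pose R i := iter i (fun Y => Y `\` [set z | wo_lt z (f Y)]) X.
have nR i : ~ thin k.+1 (R i) by elim: i => //= i /fP[].
have Rdec i j : i <= j -> R j `<=` R i.
  move=> /subnKC <-; elim: (j - i) => [|d IH]; rewrite ?addn0 // addnS /=.
  by apply: subset_trans IH => y [].
exists (fun i => R i `&` [set z | wo_lt z (f (R i))]); split.
- by move=> i y [+ _]; apply: (Rdec 0).
- by move=> i; have [] := fP _ (nR i).
- move=> i j x y ltij [_ /= xi] [/(Rdec i.+1 j ltij)[_ /= yi] _].
  by apply: wo_lt_le_trans xi _; apply/negPn/negP.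
Qed.

(** Were [X] thin, almost all blocks would meet it in a [thin k] set, by induction on its
    generation: if a generator [Y] met two blocks in thick sets, the segment of [Y] at a point of
    the later block would contain the thick part of the earlier one. *)
Lemma blocks_thick k X (B : nat -> set A) : increasing_blocks B ->
  (forall i, B i `<=` X) -> (forall m, exists2 i, m <= i & ~ thin k (B i)) ->
  ~ thin k.+1 X.
Proof.
move=> incB BX nB tX.
suff [m tm] : exists m, forall i, m <= i -> thin k (B i `&` X).
  by have [i mi] := nB m; apply; rewrite -(setIidl (BX i)); exact: tm.
elim: tX => [|X1 Y Z _ [m IH] sY ZU].
  by exists 0 => i _; rewrite setI0; exact: thin0.
suff [m' tm'] : exists m', forall i, m' <= i -> thin k (B i `&` Y).
  exists (maxn m m') => i; rewrite geq_max => /andP[/IH t1 /tm' t2].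
  by apply: thinS (thinU t1 t2) => x [Bx /ZU[]]; [left|right].
apply: contrapT => nm'.
have large m' : exists2 i, m' <= i & ~ thin k (B i `&` Y).
  apply: contrapT => no; apply: nm'; exists m' => i mi.
  by apply: contrapT => ?; apply: no; exists i.
have [i _ ni] := large 0; have [j ltij nj] := large i.+1.
have [y [Bjy Yy]] : (B j `&` Y) !=set0.
  apply: contrapT => e; apply: nj; apply: (thinS _ (thin0 k)) => y ?.
  by apply: e; exists y.
apply: ni; apply: thinS (sY y Yy) => x [Bix Yx]; split=> //.
exact: incB ltij Bix Bjy.
Qed.

(* The blocks [D j] are the nodes at height [k] of a tree witnessing that [X]
   has type at least omega ^ (l + k). *)
Lemma thick_tree k l X : ~ thin (l + k) X ->
  exists D : nat -> set A, (forall j, D j `<=` X /\ ~ thin k (D j)) /\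
    forall m B, (forall j, ~ thin m (B `&` D j)) -> ~ thin (l + m) B.
Proof.
elim: l X => [|l IH] X nX.
  exists (fun=> X); split=> [_|m B /(_ 0) nB]; first by split.
  apply: contra_not nB.
  by apply: thinS => x [].
have [B0 [B0X nB0 incB0]] := thick_blocks nX.
have /choice[D DP] := fun i => IH _ (nB0 i).
(* One sequence lists the nodes of all the subtrees through codes of pairs; a number coding no pair
   gets [D 0 0], again a node. *)
exists (fun j =>
  if (choice.unpickle j : option (nat * nat)) is Some (a, b) then D a b else D 0 0).
split=> [j|m B nB].
  have DX a b : D a b `<=` X /\ ~ thin k (D a b).
    have [/(_ b)[DB nD] _] := DP a; split=> //.
    by apply: subset_trans DB _; exact: B0X.
  by case: (choice.unpickle j : option (nat * nat)) => [[a b]|]; exact: DX.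
apply: (@blocks_thick _ _ (fun i => B `&` B0 i)).
- by move=> i j x y ltij [_ Bx] [_ By]; exact: incB0 ltij Bx By.
- by move=> i x [].
- move=> i; exists i => //.
  have [DX /(_ m (B `&` B0 i))] := DP i; apply=> j.
  have := nB (choice.pickle (i, j)); rewrite choice.pickleK; apply: contra_not.
  by apply: thinS => x [Bx Dx]; split=> //; split=> //; exact: (DX j).1.
Qed.

End ThinTheory.

(** The outer induction lowers the rank inside segments, the inner one follows the generation of
    [Y]. This is the tool for comparing types across different orders. *)
Lemma thin_preimage (A B : wellOrder) (f : A -> B) k (X : set A) (Y : set B) :
  {in X &, {homo f : x y / wo_lt x y}} -> f @` X `<=` Y -> thin k Y -> thin k X.
Proof.
elim: k X Y => [|k IH] X Y fX XY /=.
  move=> Y0; rewrite -subset0 => x Xx.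
  by have := XY _ (imageP f Xx); rewrite Y0.
move=> tY; elim: tY X fX XY => [|Y1 Y2 Z _ IHY sY2 ZU] X fX XY.
  have -> : X = set0 by rewrite -subset0 => x Xx; exact: (XY _ (imageP f Xx)).
  exact: SegGenerated0.
have sub (P : set A) : {in X `&` P &, {homo f : x y / wo_lt x y}}.
  by move=> x y; rewrite !inE => -[Xx _] [Xy _]; apply: fX; exact/mem_set.
apply: (@thinS _ k.+1 _ ((X `&` f @^-1` Y1) `|` (X `&` f @^-1` Y2))).
  by move=> x Xx; have /ZU[] := XY _ (imageP f Xx); [left|right].
apply: thinU.
- by apply: IHY => [|_ [x [_ Y1x] <-]]; first exact: sub.
- apply: thin_segments => y [Xy Y2y].
  apply: IH (sY2 _ Y2y); first by rewrite -setIA; exact: sub.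
  move=> _ [x [[Xx Y2x] /= xy] <-]; split=> //=.
  by apply: fX => //; exact/mem_set.
Qed.

(** * Positive sets and normal forms of functions *)

Lemma recursive_choice (T : Type) (R : nat -> seq T -> T -> Prop) :
  (forall n s, exists x, R n s x) ->
  exists u : nat -> T, forall n, R n (mkseq u n) (u n).
Proof.
move=> exR.
have /choice[f fP] : forall p : nat * seq T, exists x, R p.1 p.2 x.
  by move=> p; exact: exR.
pose L := fix L n := if n is m.+1 then rcons (L m) (f (m, L m)) else [::].
exists (fun n => f (n, L n)) => n.
suff -> : mkseq (fun n => f (n, L n)) n = L n by exact: (fP (n, L n)).
by elim: n => //= n IH; rewrite mkseqS IH.
Qed.

Lemma mem_mkseq (T : eqType) (u : nat -> T) i n : i < n -> u i \in mkseq u n.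
Proof. by move=> ltin; apply/mapP; exists i; rewrite ?mem_iota. Qed.

Lemma infinite_inj_nat (T : Type) (X : set T) (u : nat -> T) :
  injective u -> (forall n, X (u n)) -> infinite_set X.
Proof.
move=> uinj Xu finX; apply: infinite_nat.
apply: (@sub_finite_set _ _ (u @^-1` X)); first by move=> n _; exact: Xu.
by apply: finite_preimage finX => m n _ _; exact: uinj.
Qed.

(** Step [n] serves [D (J n)], where [J] takes every value infinitely often, and picks a point whose
    value under [g] is new. *)
Lemma injective_selection (T : eqType) (V : Type) (g : T -> V) (D : nat -> set T) :
  (forall j (s : seq T), exists2 x, D j x & forall y, y \in s -> g y <> g x) ->
  exists B : set T, {in B &, injective g} /\ forall j, infinite_set (B `&` D j).
Proof.
move=> exD.
pose J n : nat := if (choice.unpickle n : option (nat * nat)) is Some p then p.1 else 0.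
have [u uP] : exists u : nat -> T, forall n,
    D (J n) (u n) /\ forall y, y \in mkseq u n -> g y <> g (u n).
  apply: (@recursive_choice _ (fun n s x =>
    D (J n) x /\ forall y, y \in s -> g y <> g x)).
  by move=> n s; have [x] := exD (J n) s; exists x.
have guinj : injective (g \o u).
  move=> m n /= E; have [lt|lt|//] := ltngtP m n.
  - by have [_ /(_ (u m) (mem_mkseq u lt))] := uP n.
  - by have [_ /(_ (u n) (mem_mkseq u lt))] := uP m; rewrite E.
exists (range u); split.
  by move=> x y; rewrite !inE => -[m _ <-] [n _ <-] /guinj ->.
move=> j; apply: (@infinite_inj_nat _ _ (fun i => u (choice.pickle (j, i)))).
  move=> a b E; have /guinj/(pcan_inj choice.pickleK)[//] :
    (g \o u) (choice.pickle (j, a)) = (g \o u) (choice.pickle (j, b)) by rewrite /= E.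
move=> i; split; first by exists (choice.pickle (j, i)).
by have [] := uP (choice.pickle (j, i)); rewrite /J choice.pickleK.
Qed.

Section PositiveSets.
Variable F : wellOrder.
Implicit Types (X Y Z : set F) (x y z : F).

Definition small X : Prop := exists k, thin k X.

Definition positive X : Prop := forall k, ~ thin k X.

Lemma positiveP X : positive X <-> ~ small X.
Proof.
split=> [pX [k]|nX k tX]; first exact: pX.
by apply: nX; exists k.
Qed.

Lemma smallS X Y : X `<=` Y -> small Y -> small X.
Proof. by move=> XY [k tY]; exists k; exact: thinS tY. Qed.

Lemma smallU X Y : small X -> small Y -> small (X `|` Y).
Proof.
move=> [k tX] [l tY]; exists (maxn k l); apply: thinU.
- exact: thin_leq (leq_maxl _ _) tX.
- exact: thin_leq (leq_maxr _ _) tY.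
Qed.

Lemma positiveS X Y : X `<=` Y -> positive X -> positive Y.
Proof. by move=> XY pX k tY; apply: (pX k); exact: thinS tY. Qed.

Lemma positiveD X Y : positive X -> small Y -> positive (X `\` Y).
Proof.
move=> /positiveP pX sY; apply/positiveP => sD; apply: pX.
apply: smallS (smallU sD sY) => x Xx.
by have [|] := pselect (Y x); [right|left].
Qed.

Hypothesis small_below : forall x, small [set z | wo_lt z x].

Let small_belowb x : exists n, `[< thin n [set z | wo_lt z x] >].
Proof. by have [n tn] := small_below x; exists n; apply/asboolP. Qed.

(** In omega^omega this is one more than the leading exponent of the Cantor normal form of [x], and
    0 at the least element. *)
Definition lev x : nat := ex_minn (small_belowb x).

Lemma thin_below_lev x : thin (lev x) [set z | wo_lt z x].
Proof. by rewrite /lev; case: ex_minnP => n /asboolP. Qed.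

Lemma lev_min n x : thin n [set z | wo_lt z x] -> lev x <= n.
Proof. by rewrite /lev; case: ex_minnP => m _ min tn; apply/min/asboolP. Qed.

Lemma lev_mono x y : wo_lt x y -> lev x <= lev y.
Proof.
move=> xy; apply: lev_min; apply: thinS (thin_below_lev y) => z /=.
by move=> zx; exact: wo_lt_trans xy.
Qed.

Lemma thin_lev_le n : thin n.+1 [set x | lev x <= n].
Proof.
apply: thin_segments => y /= yn; apply: thinS (thin_leq yn (thin_below_lev y)).
by move=> x [].
Qed.

Definition fiber n : set F := [set x | lev x = n].

Lemma small_fiber n : small (fiber n).
Proof. by exists n.+1; apply: thinS (thin_lev_le n) => x /= ->. Qed.

(** A segment of [X] at [y] meets only the finitely many levels up to [lev y]. Levels below [m] are
    [thin k] anyway, so if all others met [X] in [thin k] sets, every segment would be [thin k]. *)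
Lemma thick_fiber k m X : ~ thin k.+1 X -> m <= k ->
  exists2 n, m <= n & ~ thin k (X `&` fiber n).
Proof.
move=> nX mk; apply: contrapT => no; apply: nX; apply: thin_segments => y _.
apply: (thinS _ (@thin_bigU _ k _ (iota 0 (lev y).+1) (fun n => X `&` fiber n) _)).
  by move=> x [Xx /lev_mono lexy]; exists (lev x); rewrite // mem_iota.
move=> n _; have [mn|nm] := leqP m n.
  by apply: contrapT => nt; apply: no; exists n.
apply: (thinS _ (thin_leq (leq_trans nm mk) (thin_lev_le n))).
by move=> x [_ /= ->].
Qed.

Lemma positive_fibers X : positive X ->
  exists u : nat -> nat, {homo u : i j / i < j} /\
    forall i, ~ thin i (X `&` fiber (u i)).
Proof.
move=> pX; have [u uP] : exists u : nat -> nat, forall i,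
    ~ thin i (X `&` fiber (u i)) /\ forall n, n \in mkseq u i -> n < u i.
  apply: (@recursive_choice _ (fun i s n => ~ thin i (X `&` fiber n) /\
    forall m, m \in s -> m < n)) => i s.
  (* At this bound [thick_fiber] yields a level above all earlier ones that meets [X] in a set not
     [thin i]. *)
  pose k := maxn i (\max_(m <- s) m).+1.
  have [n kn nn] := thick_fiber (pX k.+1) (leqnn k).
  exists n; split=> [ti|m ms].
    by apply: nn; exact: thin_leq (leq_maxl _ _) ti.
  apply: leq_trans kn; rewrite leq_max ltnS; apply/orP; right.
  by rewrite (big_rem _ ms) /= leq_maxl.
exists u; split=> [i j ltij|i]; last by have [] := uP i.
by have [_] := uP j; apply; exact: mem_mkseq.
Qed.

(* The union over [i] of a large piece of one fiber of [X 0 `&` ... `&` X i]. *)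
Lemma pseudo_intersection (X : nat -> set F) :
  (forall i, positive [set x | forall j, j <= i -> X j x]) ->
  exists2 Y, positive Y & forall i, small (Y `\` X i).
Proof.
move=> pX.
have /choice[n nP] : forall i, exists n,
    ~ thin i ([set x | forall j, j <= i -> X j x] `&` fiber n).
  by move=> i; have [n _] := thick_fiber (pX i i.+1) (leq0n i); exists n.
exists [set x | exists i, (forall j, j <= i -> X j x) /\ fiber (n i) x].
  move=> k tk; apply: (nP k); apply: thinS tk => x [Xx nx].
  by exists k.
move=> i; pose f := fun j => fiber (n j).
apply: (@smallS _ [set x | exists2 j, j < i & f j x]).
  move=> x [[j [Xx nx]] nXx]; exists j => //.
  by rewrite ltnNge; apply/negP => /Xx.
elim: i => [|i IH]; first by exists 0; rewrite /= -subset0 => x [].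
apply: smallS (smallU IH (small_fiber (n i))) => x [j].
by rewrite ltnS leq_eqVlt => /orP[/eqP->|ltji] fx; [right|left; exists j].
Qed.

Definition canonical_on (V : Type) (g : F -> V) X : Prop :=
  [\/ forall x y, X x -> X y -> g x = g y,
      forall x y, X x -> X y -> g x = g y <-> lev x = lev y |
      {in X &, injective g}].

(** A tree node is not [thin k], so finitely many preimages never cover it and an injective
    selection can pick infinitely many points in each node of the trees for all [l]. An infinite set
    is not [thin 1], so by the tree property the selection is not [thin (l + 1)]. *)
Lemma canonize_injective (V : Type) (g : F -> V) k X : positive X ->
  (forall v, thin k (X `&` g @^-1` [set v])) ->
  exists Y, [/\ Y `<=` X, positive Y & {in Y &, injective g}].
Proof.
move=> pX tg.
have /choice[D DP] := fun l => thick_tree (pX (l + k)).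
pose E n :=
  if (choice.unpickle n : option (nat * nat)) is Some (a, b) then D a b else D 0 0.
have ED n : exists l j, E n = D l j.
  rewrite /E; case: (choice.unpickle n : option (nat * nat)) => [[a b]|].
    by exists a, b.
  by exists 0, 0.
have [|B [gB infB]] := @injective_selection _ _ g E.
  move=> n s; have [l [j ->]] := ED n; apply: contrapT => no.
  have [/(_ j)[DX nD] _] := DP l; apply: nD.
  apply: (thinS _ (@thin_bigU _ k _ s (fun y => X `&` g @^-1` [set g y]) _)) => //.
  move=> x Dx; apply: contrapT => nx; apply: no; exists x => // y ys gyx.
  by apply: nx; exists y => //; split; [exact: DX Dx | rewrite /= gyx].
exists (B `&` X); split.
- by move=> x [].
- move=> l tl; have [DX nB] := DP l.
  apply: (nB 1 (B `&` X)); last by rewrite addn1; exact: thin_succ.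
  move=> j /thin1_finite; have := infB (choice.pickle (l, j)).
  rewrite /E choice.pickleK; apply: contra_not; apply: sub_finite_set => x [Bx Dx].
  by split=> //; split=> //; exact: (DX j).1 Dx.
- by move=> x y; rewrite !inE => -[Bx _] [By _]; apply: gB; exact/mem_set.
Qed.

(* If the preimages of points have bounded rank in [X], new values can be found
   indefinitely in any large block.  Otherwise either one preimage is positive, or
   larger and larger preimages of distinct values can be placed on distinct levels. *)
Lemma canonize (V : Type) (g : F -> V) X : positive X ->
  exists Y, [/\ Y `<=` X, positive Y & canonical_on g Y].
Proof.
move=> pX.
have [[k tk]|nk] := pselect (exists k, forall v, thin k (X `&` g @^-1` [set v])).
  have [Y [YX pY gY]] := canonize_injective pX tk.
  by exists Y; split=> //; exact: Or33.
have [[v pv]|nv] := pselect (exists v, positive (X `&` g @^-1` [set v])).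
  exists (X `&` g @^-1` [set v]); split=> //.
  by apply: Or31 => x y [_ /= ->] [_ /= ->].
have sv v : small (X `&` g @^-1` [set v]).
  by apply: contrapT => /positiveP pv; apply: nv; exists v.
have /choice[K KP] := sv.
pose P x := X `&` (g @^-1` [set g x] `&` fiber (lev x)).
have [u uP] : exists u : nat -> F, forall i, ~ thin i (P (u i)) /\
    forall y, y \in mkseq u i -> g y <> g (u i) /\ lev y < lev (u i).
  apply: (@recursive_choice _ (fun i s x => ~ thin i (P x) /\
    forall y, y \in s -> g y <> g x /\ lev y < lev x)) => i s.
  (* A preimage that is not [thin k.+1] cannot belong to an earlier value [g y], whose preimage is
     [thin (K (g y))], and a level at least [k] lies beyond every earlier [lev y]. *)
  pose k := i + \sum_(y <- s) (K (g y) + (lev y).+1).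
  have [v nv'] : exists v, ~ thin k.+1 (X `&` g @^-1` [set v]).
    apply: contrapT => no; apply: nk; exists k.+1 => v.
    by apply: contrapT => ?; apply: no; exists v.
  have [n kn nn] := thick_fiber nv' (leqnn k).
  have [x [[Xx /= gx] nx]] : (X `&` g @^-1` [set v] `&` fiber n) !=set0.
    apply: contrapT => e; apply: nn; apply: (thinS _ (thin0 F k)) => x ?.
    by apply: e; exists x.
  have kle y : y \in s -> K (g y) + (lev y).+1 <= k.
    by move=> ys; rewrite /k (big_rem _ ys) /= addnCA leq_addr.
  exists x; split=> [ti|y ys].
    apply: nn; apply: thinS (thin_leq (leq_addr _ _) ti) => z [[Xz gz] nz].
    by rewrite /P /= gx nx.
  have {kle}kle := kle y ys.
  split=> [gyx|]; last first.
    rewrite nx; apply: leq_trans kn; apply: leq_trans kle.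
    by rewrite leq_addl.
  apply: nv'; rewrite -gx -gyx; apply: thin_leq (KP _).
  by apply: leqW; apply: leq_trans kle; rewrite leq_addr.
have uinj i j : g (u i) = g (u j) \/ lev (u i) = lev (u j) -> i = j.
  move=> E; have [lt|lt|//] := ltngtP i j.
  - have [_ /(_ _ (mem_mkseq u lt))[ng nl]] := uP j.
    by case: E => // E; move: nl; rewrite E ltnn.
  - have [_ /(_ _ (mem_mkseq u lt))[ng nl]] := uP i.
    by case: E => E; [have := ng (esym E) | move: nl; rewrite E ltnn].
exists [set x | exists i, P (u i) x]; split.
- by move=> x [i []].
- by move=> k tk; have [+ _] := uP k; apply; apply: thinS tk => x Px; exists k.
- apply: Or32 => x y [i [_ [/= gx lx]]] [j [_ [/= gy ly]]].
  move: lx ly; rewrite /fiber /= => lx ly; rewrite gx gy lx ly.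
  split=> E; first by rewrite (uinj i j (or_introl E)).
  by rewrite (uinj i j (or_intror E)).
Qed.

End PositiveSets.

(** * Images in a well-order *)

Section Images.
Variables (F A : wellOrder) (h : F -> A) (e : nat -> F).
Hypothesis e_surj : forall x, exists n, e n = x.

(* [Q a] says that cutting at [a] keeps infinitely many [Y i] large.  Below the
   least such cut every [a] may be skipped by almost all [Y i], so these can be
   thinned out until their images are almost disjoint from each segment. *)
Lemma thin_out_images (c : nat -> nat) (Y : nat -> set F) :
  (forall i, ~ thin (c i) (Y i)) ->
  exists Y' : nat -> set F, [/\ forall i, Y' i `<=` Y i,
    forall m, exists2 i, m <= i & ~ thin (c i) (Y' i) &
    forall i x, Y' i x ->
      exists m, forall j y, m <= j -> Y' j y -> ~~ wo_lt (h y) (h x)].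
Proof.
move=> nY.
pose Q a := forall m, exists2 i, m <= i &
  ~ thin (c i) (Y i `&` h @^-1` [set b | wo_lt b a]).
have [C [infM nQ]] : exists C : set A,
    (forall m, exists2 i, m <= i & ~ thin (c i) (Y i `&` h @^-1` C)) /\
    forall a, C a -> ~ Q a.
  have [Q0|Q0] := pselect (Q !=set0).
    have [g Qg gmin] := wo_min Q0; exists [set b | wo_lt b g]; split=> // a.
    by move=> /negP ag /gmin.
  exists setT; split=> [m|a _ Qa]; last by apply: Q0; exists a.
  by exists m => //; rewrite preimage_setT setIT; exact: nY.
pose Z i := Y i `&` h @^-1` C.
pose cut i x := Z i `&` h @^-1` [set b | wo_lt b (h x)].
(* Stage [i] discards the thin cuts at the first [i.+1] points of the enumeration [e]. Only finitely
   many thin pieces go, so a thick [Z i] stays thick. *)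
exists (fun i y => [/\ ~ thin (c i) (Z i), Z i y &
  forall j, j <= i -> thin (c i) (cut i (e j)) -> ~~ wo_lt (h y) (h (e j))]); split.
- by move=> i y [_ []].
- move=> m; have [i mi nZ] := infM m; exists i => //; apply: contra_not nZ => tY'.
  pose s := [seq j <- iota 0 i.+1 | `[< thin (c i) (cut i (e j)) >]].
  have tcut : thin (c i) [set x | exists2 j, j \in s & cut i (e j) x].
    by apply: thin_bigU => j; rewrite mem_filter => /andP[/asboolP].
  have [tZ|nZ] := pselect (thin (c i) (Z i)); first exact: tZ.
  apply: thinS (thinU tY' tcut) => y Zy.
  have [[j js cy]|no] := pselect (exists2 j, j \in s & cut i (e j) y).
    by right; exists j.
  left; split=> // j ji tj; apply/negP => lt; apply: no; exists j => //.
  by rewrite mem_filter mem_iota ltnS ji !andbT; exact/asboolP.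
- move=> i x [_ [_ Cx] _].
  have [m tm] : exists m, forall i, m <= i ->
      thin (c i) (Y i `&` h @^-1` [set b | wo_lt b (h x)]).
    apply: contrapT => no; apply: (nQ _ Cx) => m; apply: contrapT => no'.
    apply: no; exists m => j mj; apply: contrapT => nt; apply: no'.
    by exists j.
  have [n ex] := e_surj x; exists (maxn m n) => j y.
  rewrite geq_max => /andP[mj nj] [_ _ /(_ n nj)]; rewrite ex; apply.
  by apply: thinS (tm j mj) => z [[]].
Qed.

(** Only the pieces before [m] can send points below [h x], and a finite union of thin images is
    thin. *)
Lemma image_segments_bound (k m i : nat) (Y Y' : nat -> set F) x :
  (forall j, j < m -> thin k (h @` Y j)) -> (forall j, Y' j `<=` Y j) ->
  (forall j y, m <= j -> Y' j y -> ~~ wo_lt (h y) (h x)) ->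
  thin k (h @` [set y | exists j, Y' j y] `&` [set a | wo_lt a (h x)]).
Proof.
move=> tY Y'Y mP.
apply: (thinS _ (@thin_bigU _ k _ (iota 0 m) (fun j => h @` Y j) _)).
  move=> _ [[y [j Y'y] <-]] /= lt; exists j; last first.
    by exists y => //; exact: Y'Y.
  rewrite mem_iota /= add0n ltnNge; apply/negP => mj.
  by have := mP j y mj Y'y; rewrite lt.
by move=> j; rewrite mem_iota => jm; exact: tY.
Qed.

(** Apply the induction hypothesis in each of the increasing blocks of [X], then thin the pieces
    out. Proper segments of the image of the union come from finitely many pieces, which raises the
    rank by just one. *)
Lemma thin_image k (X : set F) : ~ thin k X ->
  exists Y, [/\ Y `<=` X, ~ thin k Y & thin k.+1 (h @` Y)].
Proof.
elim: k X => [|k IH] X nX.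
  have [x Xx] : X !=set0.
    apply: contrapT => e0; apply: nX; rewrite /= -subset0 => x ?.
    by apply: e0; exists x.
  exists [set x]; split; first by move=> _ ->.
    by move=> /= E; have : [set x] x by []; rewrite E.
  by rewrite image_set1; exact: thin1.
have [B [BX nB incB]] := thick_blocks nX.
have /choice[Y YP] := fun i => IH _ (nB i).
have nY i : ~ thin k (Y i) by have [] := YP i.
have [Y' [Y'Y nY' sY']] := thin_out_images nY.
exists [set x | exists i, Y' i x]; split.
- by move=> x [i /Y'Y]; have [YB _ _] := YP i => /YB; exact: BX.
- apply: (@blocks_thick _ _ _ Y') => //; last by move=> i x; exists i.
  move=> i j x y ltij /Y'Y Yx /Y'Y Yy; apply: incB ltij _ _.
  + by have [YB _ _] := YP i; exact: YB.
  + by have [YB _ _] := YP j; exact: YB.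
- apply: thin_segments => _ [x [i Y'x] <-]; have [m mP] := sY' i x Y'x.
  by apply: image_segments_bound mP => // j _; have [] := YP j.
Qed.

(** Here the pieces have growing rank [i] with images [thin i.+1]; those before [m] all have images
    [thin m], so each segment is small. *)
Lemma positive_image (X : set F) : positive X ->
  exists Y, [/\ Y `<=` X, positive Y &
    forall a, (h @` Y) a -> small (h @` Y `&` [set b | wo_lt b a])].
Proof.
move=> pX; have /choice[Y YP] := fun i => thin_image (pX i).
have nY i : ~ thin (id i) (Y i) by have [] := YP i.
have [Y' [Y'Y nY' sY']] := thin_out_images nY.
exists [set x | exists i, Y' i x]; split.
- by move=> x [i /Y'Y]; have [YX _ _] := YP i => /YX.
- move=> k tk; have [i ki] := nY' k; apply; apply: thin_leq ki _.
  by apply: thinS tk => x; exists i.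
- move=> _ [x [i Y'x] <-]; have [m mP] := sY' i x Y'x; exists m.
  apply: image_segments_bound mP => // j jm.
  by apply: thin_leq jm _; have [] := YP j.
Qed.

End Images.

(** * Comparability of well-orders *)

Lemma wo_comparable (A B : wellOrder) : wo_le A B \/
  exists x : A, exists2 f : B -> A, {homo f : a b / wo_lt a b} & forall b, wo_lt (f b) x.
Proof.
have /choice[nxt nxtP] : forall S : set B, exists o : option B,
    if o is Some b then (forall c, S c -> wo_lt c b) /\
                        (forall b', (forall c, S c -> wo_lt c b') -> wo_rel b b')
    else ~ exists b, forall c, S c -> wo_lt c b.
  move=> S; have [ex|nex] := pselect (exists b, forall c, S c -> wo_lt c b).
    by have [b Sb bmin] := wo_min ex; exists (Some b).
  by exists None.
(* [f x] is the least element of [B] above all earlier values, or [None] when there is none. If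
   [None] never occurs, [f] embeds [A] as an initial segment; if it occurs at [x], the points below
   [x] already reach all of [B]. *)
pose step (x : A) (rec : forall y : A, wo_lt y x -> option B) :=
  nxt [set c | exists y, exists yx : wo_lt y x, rec y yx = Some c].
pose f := Fix (@wo_lt_wf A) (fun=> option B) step.
have fE x : f x = nxt [set c | exists2 y, wo_lt y x & f y = Some c].
  rewrite /f Fix_eq; last first.
    move=> z r r' rE; congr nxt; apply/seteqP.
    by split=> c [y [yz E]]; exists y, yz; [rewrite -rE|rewrite rE].
  congr nxt; apply/seteqP; split=> c [y yx]; last by exists y, yx.
  by case: yx => yx; exists y.
have fmono x y b c : f x = Some b -> f y = Some c -> wo_lt x y -> wo_lt b c.
  move=> fx fy xy; have := nxtP [set c | exists2 z, wo_lt z y & f z = Some c].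
  by rewrite -fE fy => -[+ _]; apply; exists x.
have finit x b c : f x = Some b -> wo_lt c b -> exists2 y, wo_lt y x & f y = Some c.
  elim/(well_founded_ind (@wo_lt_wf A)): x b => x IH b fx cb.
  have := nxtP [set c | exists2 z, wo_lt z x & f z = Some c].
  rewrite -fE fx => -[_ bmin].
  have [d [[z zx fz] cd]] : exists d, (exists2 z, wo_lt z x & f z = Some d) /\ wo_rel c d.
    apply: contrapT => no; move/negP: cb; apply; apply: bmin => d Sd.
    by apply/negP => cd; apply: no; exists d.
  have [dc|lt|lt] := wo_ltP c d; first by exists z; rewrite // fz dc.
    have [y yz fy] := IH z zx d fz lt; exists y => //; exact: wo_lt_trans zx.
  by move: lt; rewrite /wo_lt cd.
have [[x fx]|all] := pselect ([set x | f x = None] !=set0); [right|left].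
  have := nxtP [set c | exists2 z, wo_lt z x & f z = Some c]; rewrite -fE fx => no.
  have /choice[g gP] : forall b, exists y, wo_lt y x /\ f y = Some b.
    move=> b; apply: contrapT => nb; apply: no; exists b => c [z zx fz].
    apply/negP => bc; apply: nb; have [E|lt|lt] := wo_ltP b c.
    - by exists z; rewrite E.
    - have [y yz fy] := finit z c b fz lt; exists y; split=> //; exact: wo_lt_trans zx.
    - by move: lt; rewrite /wo_lt bc.
  exists x, g; last by move=> b; have [] := gP b.
  move=> a b ab; have [_ fa] := gP a; have [_ fb] := gP b.
  apply/negP => gba; have [E|lt|lt] := wo_ltP (g a) (g b).
  - by move: fa; rewrite E fb => -[E']; move: ab; rewrite E' wo_ltxx.
  - by move: lt; rewrite /wo_lt gba.
  - have := fmono _ _ _ _ fb fa lt; apply/negP; rewrite /wo_lt negbK.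
    exact: wo_ltW.
have /choice[g gP] : forall x, exists b, f x = Some b.
  move=> x; case E: (f x) => [b|]; first by exists b.
  by case: all; exists x.
have gmono x y : wo_lt x y -> wo_lt (g x) (g y) by exact: fmono.
exists g; split=> [x y|x b].
  have [->|lt|lt] := wo_ltP x y; first by rewrite !wo_refl.
  - by rewrite !wo_ltW //; exact: gmono.
  - by have := gmono _ _ lt; rewrite /wo_lt => /negbTE ->; apply/esym/negbTE.
have [E _|lt _|lt] := wo_ltP b (g x); first by exists x.
- by have [y _] := finit _ _ _ (gP x) lt; rewrite gP => -[]; exists y.
- by move: lt; rewrite /wo_lt => /negbTE ->.
Qed.

(** * Infinite Ramsey theorem *)

Lemma finite_set_nat_bounded (X : set nat) :
  finite_set X -> exists b, forall n, X n -> n < b.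
Proof.
move=> finX; have [X0|X0] := pselect (X !=set0); last first.
  by exists 0 => n Xn; case: X0; exists n.
have [m _ mX] := @finite_wo_max omega X finX X0.
by exists m.+1 => n /mX.
Qed.

Lemma ultrafilter_limit (G : set_system nat) (f : nat -> nat) l :
  UltraFilter G -> G [set n | f n < l] -> exists2 v, v < l & G [set n | f n = v].
Proof.
move=> uG; elim: l => [|l IH] Gl.
  by have [n] := filter_ex Gl.
have [Gv|Gv] := in_ultra_setVsetC [set n | f n = l] uG; first by exists l.
have [|v vl Gfv] := IH; last by exists v => //; exact: ltnW.
apply: filterS (filterI Gl Gv) => n [] /=.
by rewrite ltnS leq_eqVlt => /orP[/eqP->|].
Qed.

Lemma ultrafilter_on (N : set nat) : infinite_set N ->
  exists2 G : set_system nat, UltraFilter G &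
    forall X, finite_set (N `\` X) -> G X.
Proof.
move=> infN; pose G0 : set_system nat := [set X | finite_set (N `\` X)].
have pG0 : ProperFilter G0.
  split; first by rewrite /G0 /= setD0.
  split=> [|P Q fP fQ|P Q PQ]; rewrite /G0 /=.
  - by rewrite setDT; exact: finite_set0.
  - by rewrite setDIr finite_setU.
  - by apply: sub_finite_set => x [Nx nQ]; split=> // /PQ.
by have [G [uG G0G]] := ultraFilterLemma pG0; exists G => // X; exact: G0G.
Qed.

(* Induction on [k]: along an ultrafilter on [N], every [k]-set gets a limit
   colour; make [c] depend on the limit colour of all but the last point. *)
Lemma infinite_ramsey k l (c : {fset nat} -> nat) (N : set nat) :
  (forall s, #|` s| = k -> c s < l) -> infinite_set N ->
  exists H, [/\ H `<=` N, infinite_set H & forall s t, #|` s| = k -> #|` t| = k ->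
    [set` s] `<=` H -> [set` t] `<=` H -> c s = c t].
Proof.
elim: k c N => [|k IH] c N cl infN.
  by exists N; split=> // s t /cardfs0_eq -> /cardfs0_eq ->.
have [G uG cofG] := ultrafilter_on infN.
have finG n : G [set x | n < x].
  apply: cofG; apply: (sub_finite_set _ (finite_II n.+1)) => x [_ /= nx].
  by rewrite /= ltnS leqNgt; apply/negP.
have /choice[c' c'P] : forall s : {fset nat}, exists v, #|` s| = k ->
    v < l /\ G [set n | c (n |` s)%fset = v].
  move=> s; have [sk|nk] := pselect (#|` s| = k); last by exists 0.
  have [|v vl Gv] := @ultrafilter_limit G (fun n => c (n |` s)%fset) l uG.
    apply: cofG; apply: (sub_finite_set _ (finite_fset s)) => n [_ /= nl].
    apply: contrapT => /negP ns; apply: nl; apply: cl.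
    by rewrite cardfsU1 ns sk.
  by exists v.
(* The new point gives each [k]-set of earlier points its limit colour; only finitely many sets in
   [G] have to be met. *)
pose R (i : nat) (s : seq nat) x := [/\ N x, forall y, y \in s -> y < x &
  forall t : {fset nat}, {subset t <= s} -> #|` t| = k -> c (x |` t)%fset = c' t].
have [i s|u uP] := @recursive_choice _ R.
  pose S := fpowerset [fset x in s]%fset.
  have GS : G (\bigcap_(t in [set` S]) [set x | #|` t| = k -> c (x |` t)%fset = c' t]).
    apply: filter_bigI => t _; have [tk|nk] := pselect (#|` t| = k).
      by apply: filterS (c'P t tk).2 => x /= ->.
    by apply: filterS filterT => x _ /nk.
  have Gs : G [set x | forall y, y \in s -> y < x].
    apply: filterS (finG (\max_(y <- s) y)) => x /= sx y ys.
    by apply: leq_ltn_trans sx; rewrite (big_rem _ ys) /= leq_maxl.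
  have GN : G N by apply: cofG; rewrite setDv; exact: finite_set0.
  have [x [Nx [sx Sx]]] := filter_ex (filterI GN (filterI Gs GS)).
  exists x; split=> // t ts; apply: Sx; rewrite /= fpowersetE.
  by apply/fsubsetP => y /ts ys; rewrite !inE.
have umono i j : i < j -> u i < u j.
  by move=> ij; have [_ + _] := uP j; apply; exact: mem_mkseq.
have uinj : injective u.
  by move=> i j E; have [/umono|/umono|//] := ltngtP i j; rewrite E ltnn.
have infu : infinite_set (range u).
  by apply: (infinite_inj_nat uinj) => n; exists n.
have [s sk|H [Hu infH homH]] := IH c' (range u) _ infu.
  by have [] := c'P s sk.
exists H; split=> // [x /Hu[i _ <-]|]; first by have [] := uP i.
(* Removing the largest point of [s] leaves a [k]-set of earlier terms of [u], so the colour of [s]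
   is the limit colour of that set. *)
have red s : #|` s| = k.+1 -> [set` s] `<=` H ->
    exists t, [/\ #|` t| = k, [set` t] `<=` H & c s = c' t].
  move=> sk sH.
  have [|x xs xmax] := @finite_wo_max omega [set` s] (finite_fset s).
    by have : 0 < #|` s| by [rewrite sk]; rewrite cardfs_gt0 => /fset0Pn[y ys]; exists y.
  have [i _ ui] := Hu _ (sH _ xs).
  have sE : s = (u i |` (s `\ x))%fset by rewrite ui fsetD1K.
  have dk : #|` (s `\ x)%fset| = k by move: sk; rewrite (cardfsD1 x) xs => -[].
  exists (s `\ x)%fset; split=> //.
    by move=> y /=; rewrite in_fsetD1 => /andP[_ ys]; exact: sH.
  rewrite {1}sE; have [_ _ ->//] := uP i; move=> y.
  rewrite in_fsetD1 => /andP[yx ys]; have [j _ uj] := Hu _ (sH _ ys).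
  have yltx : y < x by rewrite ltn_neqAle yx; exact: xmax.
  rewrite -uj; apply: mem_mkseq; rewrite ltnNge leq_eqVlt.
  apply/negP => /orP[/eqP E|/umono].
    by move: yltx; rewrite -uj -ui E ltnn.
  by rewrite uj ui ltnNge ltnW.
move=> s t /red rs /red rt /rs[s' [sk s'H ->]] /rt[t' [tk t'H ->]].
exact: homH.
Qed.

(** * The ordinal omega^omega: ranks, smallness of segments, countability *)

Section OmegaOmega.
Let E := wo_exp omega omega.
Implicit Types x y t : E.

Lemma wo_exp_ltP (A B : wellOrder) (f g : wo_exp A B) :
  wo_lt f g <-> exp_lt (val f) (val g).
Proof.
split=> [/negP nle|lt].
  have [fg|//|gf] := exp_trichotomy f g; case: nle; apply/asboolP; first by left.
  by right.
apply/negP => /asboolP[gf|gf]; first by move: lt; rewrite gf; exact: exp_lt_irr.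
exact: (exp_lt_irr (exp_lt_trans lt gf)).
Qed.

Lemma omega_omega_support (f : nat -> nat) :
  (exists b, forall c, b <= c -> f c = 0) -> exists x : E, val x = f.
Proof.
move=> [b fb]; suff fP : f \in @exp_fun omega omega by exists (exist _ f fP).
apply/mem_set; apply: (sub_finite_set _ (finite_II b)) => c [a] /=.
by rewrite ltnNge; apply: contraTN => bc; rewrite /wo_lt /= fb.
Qed.

Lemma omega_omega_bounded x : exists b, forall c, b <= c -> val x c = 0 :> nat.
Proof.
have /set_mem/finite_set_nat_bounded[b bP] := valP x; exists b => c bc.
apply: contrapT => nz; have : exp_supp (val x) c.
  by exists 0; rewrite /wo_lt /= -ltnNge lt0n; exact/eqP.
by move=> /bP; rewrite ltnNge bc.
Qed.

Lemma omega_omega_update t b (v : nat) :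
  exists t' : E, forall c, val t' c = if c == b then v else val t c.
Proof.
have [b' b'P] := omega_omega_bounded t.
have [|t' E'] := @omega_omega_support (fun c => if c == b then v else val t c).
  exists (maxn b.+1 b') => c; rewrite geq_max => /andP[bc b'c].
  by rewrite gtn_eqF // b'P.
by exists t' => c; rewrite E'.
Qed.

(** [val x c] is the coefficient of omega^c in the Cantor normal form, so this is an interval of
    type omega^b. *)
Definition agree b t : set E := [set y | forall c, b <= c -> val y c = val t c].

Lemma thin_agree b t : thin b.+1 (agree b t).
Proof.
elim: b t => [|b IH] t.
  apply: thinS (thin1 t) => y yt; apply/val_inj/funext => c; exact: yt.
apply: thin_segments => x xt.
(* Points below [x] have coefficient at most [val x b] at [b], so finitely many intervals of the
   next lower exponent cover the segment. *)
have /choice[u uP] := fun v => omega_omega_update t b v.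
apply: (thinS _ (@thin_bigU _ b.+1 _ (iota 0 (val x b : nat).+1)
  (fun v => agree b (u v)) _)) => // y.
move=> [yt /= /wo_exp_ltP[d [lt above]]].
exists (val y b : nat).
  rewrite -[_ :: _]/(iota 0 (val x b : nat).+1) mem_iota /= add0n ltnS.
  have [E'|db|bd] := ltngtP d b.
  - by rewrite above //= /wo_lt /= -ltnNge.
  - by move: lt; rewrite yt // xt // wo_ltxx.
  - by subst d; exact: wo_ltW lt.
move=> c bc; rewrite uP; case: eqP => [->//|/eqP nbc].
by apply: yt; rewrite ltn_neqAle eq_sym nbc.
Qed.

Lemma thick_agree b t : ~ thin b (agree b t).
Proof.
elim: b t => [|b IH] t.
  by move=> /= E'; have : agree 0 t t by []; rewrite E'.
have /choice[u uP] := fun v => omega_omega_update t b v.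
apply: (@blocks_thick _ _ _ (fun v => agree b (u v))).
- move=> i j x y ij xi yj; apply/wo_exp_ltP; exists b; split.
    by rewrite xi // yj // !uP eqxx /wo_lt /= -ltnNge.
  move=> c; rewrite /wo_lt /= -ltnNge => bc.
  by rewrite (xi c (ltnW bc)) (yj c (ltnW bc)) !uP !(gtn_eqF bc).
- move=> i x xi c bc; by rewrite (xi c (ltnW bc)) uP (gtn_eqF bc).
- by move=> m; exists m.
Qed.

Lemma positive_omega_omega : positive [set: E].
Proof.
have [|x _] := @omega_omega_support (fun=> 0); first by exists 0.
by move=> k tk; apply: (@thick_agree k x); exact: thinS tk.
Qed.

Lemma small_below_omega_omega x : small [set y | wo_lt y x].
Proof.
have [b bP] := omega_omega_bounded x; exists b.+1.
apply: thinS (thin_agree b x) => y /= /wo_exp_ltP[d [lt above]] c bc.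
apply: above; rewrite /wo_lt /= -ltnNge; apply: leq_trans bc.
by rewrite ltnNge; apply/negP => /bP d0; move: lt; rewrite d0.
Qed.

Local Open Scope card_scope.

Lemma card_omega_omega : [set: E] #= [set: nat].
Proof.
have /choice[u uP] := fun x => omega_omega_bounded x.
have cE : [set: E] #<= [set: nat].
  pose f x := choice.pickle (mkseq (val x : nat -> nat) (u x)).
  apply/countable_injP; exists f => x y _ _ /(pcan_inj choice.pickleK) E'.
  have nthE (z : E) c : val z c = nth 0 (mkseq (val z : nat -> nat) (u z)) c.
    have [lt|le] := ltnP c (u z); first by rewrite nth_mkseq.
    by rewrite nth_default ?size_mkseq // uP.
  by apply/val_inj/funext => c; rewrite !nthE E'.
apply: eq_card_nat => //.
have [|x0 _] := @omega_omega_support (fun=> 0); first by exists 0.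
have /choice[v vP] := fun n => omega_omega_update x0 0 n.
apply: (@infinite_inj_nat _ _ v) => // m n E'.
by have := congr1 (fun x : E => val x 0) E'; rewrite !vP eqxx.
Qed.

End OmegaOmega.

(** * Towers of positive sets *)

Lemma ultrafilter_dichotomy (T : Type) (U : set_system T) :
  ProperFilter U -> (forall A, U A \/ U (~` A)) -> UltraFilter U.
Proof.
move=> pU dU; split=> // G pG UG; apply/seteqP; split=> // A GA.
have [//|/UG GcA] := dU A.
by have /filter_not_empty : G set0 by rewrite -(setICr A); exact: filterI.
Qed.

Lemma fmap_ultra (T V : Type) (f : T -> V) (U : set_system T) :
  UltraFilter U -> UltraFilter (fmap f U).
Proof.
move=> uU; apply: ultrafilter_dichotomy => A.
by have := in_ultra_setVsetC (f @^-1` A) uU.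
Qed.

(** On [Y] the map [f] factors through [g], and the image filter depends only on the values on a set
    of the filter. *)
Lemma RK_le_factor (U : set_system nat) (f g : nat -> nat) (Y : set nat) :
  Filter U -> U Y -> (forall x y, Y x -> Y y -> g x = g y -> f x = f y) ->
  RK_le (fmap f U) (fmap g U).
Proof.
move=> fU UY fg.
have /choice[k kP] : forall n, exists m, forall x, Y x -> g x = n -> f x = m.
  move=> n; have [[x [Yx gx]]|no] := pselect (exists x, Y x /\ g x = n).
    by exists (f x) => y Yy gy; apply: fg => //; rewrite gx gy.
  by exists 0 => x Yx gx; case: no; exists x.
exists k; apply/seteqP; split=> A /= UA.
  by apply: (filterS _ (filterI UA UY)) => x [/= + Yx]; rewrite /= (kP (g x) x).
by apply: (filterS _ (filterI UA UY)) => x [/= + Yx]; rewrite /= (kP (g x) x).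
Qed.

Lemma principal_of_singleton (T : Type) (U : set_system T) (x : T) :
  ProperFilter U -> U [set x] -> U = principal_filter x.
Proof.
move=> pU Ux; apply/seteqP; split=> A.
  by move=> UA; apply/principal_filterP; have [y [-> ]] := filter_ex (filterI Ux UA).
by move=> /principal_filterP Ax; apply: filterS Ux => y ->.
Qed.

Local Open Scope card_scope.

Lemma card_setT_bij (T V : Type) : [set: T] #= [set: V] ->
  exists f : T -> V, exists2 g : V -> T, cancel f g & cancel g f.
Proof.
move=> /card_bijP[f [g fK gK]].
pose inT (x : T) : [set: T] := exist _ x (mem_setT x).
pose inV (x : V) : [set: V] := exist _ x (mem_setT x).
exists (fun x => val (f (inT x))), (fun y => val (g (inV y))) => x.
  have -> : inV (val (f (inT x))) = f (inT x) by exact: val_inj.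
  by rewrite fK.
have -> : inT (val (g (inV x))) = g (inV x) by exact: val_inj.
by rewrite gK.
Qed.

Local Close Scope card_scope.

Lemma canonical_on_sub (F : wellOrder) sb (V : Type) (g : F -> V) X Y :
  X `<=` Y -> @canonical_on F sb V g Y -> canonical_on sb g X.
Proof.
move=> XY [c|c|c]; [apply: Or31|apply: Or32|apply: Or33].
- by move=> x y /XY Yx /XY Yy; exact: c.
- by move=> x y /XY Yx /XY Yy; exact: c.
- by move=> x y; rewrite !inE => /XY Yx /XY Yy; apply: c; exact/mem_set.
Qed.

Lemma canonical_onP (F : wellOrder) sb (V : Type) (g : F -> V) X :
  @canonical_on F sb V g X -> (forall x y, X x -> X y -> g x = g y) \/
    forall x y, X x -> X y -> g x = g y -> lev sb x = lev sb y.
Proof.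
move=> [c|c|c]; [by left|right=> x y Xx Xy|right=> x y Xx Xy E].
  by move/(c x y Xx Xy).
by congr lev; apply: c E; exact/mem_set.
Qed.

Section Tower.
Variables (F : wellOrder) (T : Type) (req : T -> set F -> Prop) (enum : omega1 -> T).
Hypothesis small_below : forall x : F, small [set z | wo_lt z x].
Hypothesis positiveT : positive [set: F].
Hypothesis req_dense : forall p X, positive X ->
  exists Y, [/\ Y `<=` X, positive Y & req p Y].

Definition tower_step (a : omega1) (R : omega1 -> set F) (Y : set F) : Prop :=
  [/\ positive Y, req (enum a) Y & forall b, wo_lt b a -> small (Y `\` R b)].

Lemma tower_step_exists (a : omega1) (R : omega1 -> set F) :
  (forall b, wo_lt b a -> positive (R b)) ->
  (forall b c, wo_lt b a -> wo_lt c b -> small (R b `\` R c)) ->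
  exists Y, tower_step a R Y.
Proof.
move=> pR decR; suff [Z pZ sZ] : exists2 Z, positive Z &
    forall b, wo_lt b a -> small (Z `\` R b).
  have [Y [YZ pY rY]] := req_dense (enum a) pZ; exists Y; split=> // b /sZ.
  by apply: smallS => x [/YZ].
have [[b0 b0a]|none] := pselect (exists b, wo_lt b a); last first.
  by exists setT => // b ba; case: none; exists b.
have /countable_injP[f finj] := omega1_segment a.
have /choice[s sP] : forall n, exists b,
    wo_lt b a /\ forall c, wo_lt c a -> f c = n -> c = b.
  move=> n; have [[b [ba fb]]|no] := pselect (exists b, wo_lt b a /\ f b = n).
    exists b; split=> // c ca fc; apply: finj; rewrite ?fb //; exact/mem_set.
  by exists b0; split=> // c ca fc; case: no; exists c.
have [|Z pZ sZ] := @pseudo_intersection F small_below (R \o s); last first.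
  exists Z => // b ba; have [_ /(_ b ba erefl) bE] := sP (f b).
  by have := sZ (f b); rewrite /= -bE.
(* Up to a small set, the intersection of finitely many tower members contains the one of largest
   index. *)
move=> i; suff [b ba sb] : exists2 b, wo_lt b a &
    small (R b `\` [set x | forall j, j <= i -> (R \o s) j x]).
  apply: positiveS (positiveD (pR b ba) sb) => x [Rx nx].
  by apply: contrapT => n; apply: nx.
elim: i => [|i [b ba sb]].
  exists (s 0); first by have [] := sP 0.
  exists 0; rewrite /= -subset0 => x [Rx []] j.
  by rewrite leqn0 => /eqP ->.
have [sa _] := sP i.+1.
have ext x : (forall j, j <= i -> R (s j) x) -> R (s i.+1) x ->
    forall j, j <= i.+1 -> R (s j) x.
  by move=> xi x1 j; rewrite leq_eqVlt => /orP[/eqP ->|/xi].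
have [E|lt|lt] := wo_ltP b (s i.+1).
- exists b => //; apply: smallS sb => x [Rx nx]; split=> // xi; apply: nx.
  by apply: ext => //; rewrite -E.
- exists (s i.+1) => //; apply: smallS (smallU (decR _ _ sa lt) sb) => x [Rx nx].
  have [Rb|nRb] := pselect (R b x); last by left.
  by right; split=> // xi; apply: nx; exact: ext.
- exists b => //; apply: smallS (smallU (decR _ _ ba lt) sb) => x [Rx nx].
  have [Rb|nRb] := pselect (R (s i.+1) x); last by left.
  by right; split=> // xi; apply: nx; exact: ext.
Qed.

Lemma tower_exists : exists X : omega1 -> set F, forall a, tower_step a X (X a).
Proof.
have /choice[next nextP] : forall p : omega1 * (omega1 -> set F), exists Y,
    (exists Y', tower_step p.1 p.2 Y') -> tower_step p.1 p.2 Y.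
  move=> p; have [[Y tY]|no] := pselect (exists Y', tower_step p.1 p.2 Y').
    by exists Y.
  by exists setT.
(* The recursion knows only the values below [a]; extending them by [setT] gives the total function
   that [tower_step] takes. *)
pose below (a : omega1) (rec : forall b : omega1, wo_lt b a -> set F) b :=
  if pselect (wo_lt b a) is left lt then rec b lt else setT.
pose X := Fix (@wo_lt_wf omega1) (fun=> set F) (fun a rec => next (a, below a rec)).
exists X => a; elim/(well_founded_ind (@wo_lt_wf omega1)): a => a IH.
pose R := below a (fun b _ => X b).
have RE b : wo_lt b a -> R b = X b.
  by move=> ba; rewrite /R /below; case: pselect.
have -> : X a = next (a, R).
  rewrite /X Fix_eq // => c r r' rE; congr (next (c, _)); apply/funext => b.
  by rewrite /below; case: pselect.
have stepE Y : tower_step a R Y -> tower_step a X Y.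
  by move=> [pY rY sY]; split=> // b ba; rewrite -RE //; exact: sY.
apply/stepE/(nextP (a, R)); apply: tower_step_exists => [b ba|b c ba cb].
  by rewrite /= RE //; have [] := IH b ba.
rewrite /= (RE b ba) (RE c (wo_lt_trans cb ba)).
by have [_ _] := IH b ba; apply.
Qed.

End Tower.

(** * Coding requirements under CH, and copies of omega^omega *)

Lemma omega1_coding : continuum_hypothesis ->
  exists enum : omega1 -> nat * (nat -> omega1), forall p, exists a, enum a = p.
Proof.
move=> /card_setT_bij[f [g fK gK]].
(* Column 0 of a subset of the plane holds the number, and column [i.+1] the subset of [nat] that
   [f] turns into the [i]-th point of [omega1]. *)
pose dec (S : set nat) : nat * (nat -> omega1) :=
  (xget 0 [set k | S (choice.pickle (0, k))],
   fun i => f [set m | S (choice.pickle (i.+1, m))]).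
exists (dec \o g) => -[k t].
pose S : set nat := [set n | exists i m, n = choice.pickle (i, m) /\
  if i is j.+1 then g (t j) m else m = k].
have SP i m : S (choice.pickle (i, m)) <-> if i is j.+1 then g (t j) m else m = k.
  split=> [[i' [m' [/(pcan_inj choice.pickleK)[<- <-]]]]//|Sim].
  by exists i, m.
exists (f S); rewrite /= /dec fK; congr pair.
  by case: xgetP => [m _ /SP//|/(_ k)]; case; apply/SP.
apply/funext => j; rewrite -[RHS]gK; congr f.
by apply/seteqP; split=> m; have [SE ES] := SP j.+1 m; [exact: SE|exact: ES].
Qed.

Lemma nat_omega_omega : exists (r : rel nat) (rP : well_order r),
  exists2 phi : WellOrder rP -> wo_exp omega omega, {homo phi : x y / wo_lt x y} &
  exists psi : wo_exp omega omega -> WellOrder rP, {homo psi : x y / wo_lt x y}.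
Proof.
have [psi [phi psiK phiK]] := card_setT_bij card_omega_omega.
have rP : well_order (fun x y : nat => wo_rel (phi x) (phi y)).
  apply: well_order_wf => [x y /wo_anti|x y|].
  - exact: can_inj phiK _ _.
  - exact: wo_total.
  - move=> x; have := erefl (phi x); move: {2}(phi x) => a.
    elim/(well_founded_ind (@wo_lt_wf (wo_exp omega omega))): a x => a IH x xa.
    by constructor => y yx; apply: (IH (phi y)) => //; rewrite -xa.
exists (fun x y => wo_rel (phi x) (phi y)), rP; exists phi => //.
by exists psi => x y; rewrite /wo_lt /= !psiK.
Qed.

(** Otherwise [omega1] would embed into the countable set omega^omega. *)
Lemma omega_omega_omega1 : exists f : wo_exp omega omega -> omega1,
  {homo f : x y / wo_lt x y}.
Proof.
have [[f [fE _]]|[x [f fmono _]]] := wo_comparable (wo_exp omega omega) omega1.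
  by exists f => x y; rewrite /wo_lt fE.
case: omega1_uncountable.
have : countable [set: wo_exp omega omega].
  by have := card_omega_omega; rewrite card_eq_le => /andP[].
move=> /countable_injP[g ginj]; apply/countable_injP; exists (g \o f).
move=> a b _ _ /ginj; rewrite !inE => /(_ I I) E.
by have [//|/fmono|/fmono] := wo_ltP a b; rewrite E wo_ltxx.
Qed.

(** * The ultrafilter generated by a tower *)

Section TowerUltrafilter.
Variables (r : rel nat) (rP : well_order r).
Let N := WellOrder rP.
Hypothesis small_belowN : forall x : N, small [set z | wo_lt z x].
Variables (code : nat -> omega1) (decode : omega1 -> nat).
Hypothesis codeK : cancel code decode.
Implicit Types (A B Y Z : set N) (k l : nat) (t : nat -> omega1).

Let level : nat -> nat := lev small_belowN.

Let color t (s : {fset nat}) : nat := decode (t (choice.pickle s)).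

(* A code [(k, t)] carries three requirements: normal forms and small images for
   [t] as a map to [omega1], and homogeneity for [t] as a colouring of k-sets. *)
Let requirement (p : nat * (nat -> omega1)) (Y : set N) : Prop :=
  [/\ canonical_on small_belowN (p.2 : N -> omega1) Y,
      forall a, (p.2 @` Y) a -> small (p.2 @` Y `&` [set b | wo_lt b a]) &
      forall l, (forall s, #|` s| = p.1 -> color p.2 s < l) ->
        forall s s', #|` s| = p.1 -> #|` s'| = p.1 ->
          [set` s] `<=` level @` Y -> [set` s'] `<=` level @` Y ->
          color p.2 s = color p.2 s'].

Lemma requirement_dense p Y : positive Y ->
  exists Z, [/\ Z `<=` Y, positive Z & requirement p Z].
Proof.
case: p => k t pY; rewrite /requirement /=.
have [Y1 [Y1Y pY1 cY1]] := canonize small_belowN (t : N -> omega1) pY.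
have idN (x : N) : exists n, id n = x by exists x.
have [Y2 [Y2Y1 pY2 sY2]] := @positive_image N omega1 t id idN Y1 pY1.
suff [Z [ZY2 pZ hZ]] : exists Z, [/\ Z `<=` Y2, positive Z &
    forall l, (forall s, #|` s| = k -> color t s < l) ->
      forall s s', #|` s| = k -> #|` s'| = k ->
        [set` s] `<=` level @` Z -> [set` s'] `<=` level @` Z ->
        color t s = color t s'].
  exists Z; split=> //; first exact/(subset_trans ZY2)/(subset_trans Y2Y1).
  split=> //; first by apply: canonical_on_sub cY1; exact: subset_trans Y2Y1.
  move=> a Za; have tZ : t @` Z `<=` t @` Y2 by exact: image_subset.
  by apply: smallS (sY2 a (tZ a Za)) => b [/tZ ? ?].
have [[l cl]|nl] := pselect (exists l, forall s, #|` s| = k -> color t s < l); last first.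
  by exists Y2; split=> // l cl; case: nl; exists l.
(* Homogeneity is sought only among levels [u i] where [Y2] is not [thin i]; an infinite set of them
   keeps the restriction positive. *)
have [u [umono uP]] := positive_fibers small_belowN pY2.
have uinj : injective u.
  by move=> i j E; have [/umono|/umono|//] := ltngtP i j; rewrite E ltnn.
have infu : infinite_set (range u).
  by apply: (infinite_inj_nat uinj) => n; exists n.
have [H [Hu infH homH]] := infinite_ramsey cl infu.
exists (Y2 `&` level @^-1` H); split=> [y []//|m tm|_ _ s s' sk s'k sH s'H].
  have [j mj Huj] : exists2 j, m <= j & H (u j).
    apply: contrapT => no; apply: infH.
    apply: (sub_finite_set _ (finite_image u (finite_II m))) => n Hn.
    have [i _ ui] := Hu n Hn; exists i => //=; rewrite ltnNge; apply/negP => mi.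
    by apply: no; exists i => //; rewrite ui.
  apply: (uP j); apply: thin_leq mj _; apply: thinS tm => y [Y2y uy].
  by split=> //; rewrite /= /level uy.
apply: homH => // [n /sH|n /s'H] [y [_ /= Hy] <-]; exact: Hy.
Qed.

Variable X : omega1 -> set N.
Hypothesis positiveX : forall a, positive (X a).
Hypothesis decreasingX : forall a b, wo_lt b a -> small (X a `\` X b).
Hypothesis requirementX : forall p, exists a, requirement p (X a).

Let U : set_system nat := [set A | exists a, small (X a `\` (A : set N))].

Lemma in_U a : U (X a).
Proof. by exists a, 0; rewrite setDv /=. Qed.

Lemma U_positive A : U A -> positive (A : set N).
Proof.
move=> [a sA]; apply: (@positiveS N _ A _ (positiveD (@positiveX a) sA)) => x [Xx nx].
by apply: contrapT => nA; apply: nx.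
Qed.

#[local] Instance U_proper : ProperFilter U.
Proof.
split; first by move=> /U_positive pos0; exact: (pos0 0 (thin0 N 0)).
split.
- by exists (code 0), 0; rewrite setDT /=.
- have le a b A : wo_lt a b -> small (X a `\` A) -> small (X b `\` A).
    move=> ab sA; apply: smallS (smallU (decreasingX ab) sA) => x [Xbx nAx].
    by have [Xax|nXax] := pselect (X a x); [right|left].
  move=> A B [a sA] [b sB].
  have [c [sA' sB']] : exists c,
      small (X c `\` (A : set N)) /\ small (X c `\` (B : set N)).
    have [E|lt|lt] := wo_ltP a b.
    - by exists a; rewrite {2}E.
    - by exists b; split=> //; exact: le lt sA.
    - by exists a; split=> //; exact: le lt sB.
  by exists c; rewrite setDIr; exact: smallU.
- move=> A B AB [a sA]; exists a; apply: smallS sA => x [Xx nB].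
  by split=> // /AB.
Qed.

Lemma U_canonical t : exists2 a,
  (forall x y, X a x -> X a y -> t x = t y) \/
  (forall x y, X a x -> X a y -> t x = t y -> level x = level y) &
  canonical_on small_belowN (t : N -> omega1) (X a).
Proof.
have [a [/= cX _ _]] := requirementX (0, t); exists a => //.
exact: canonical_onP cX.
Qed.

Lemma level_nonconstant A : positive A -> exists x y, [/\ A x, A y & level x < level y].
Proof.
move=> /(positive_fibers small_belowN)[u [umono uP]].
have pt i : exists2 x, A x & level x = u i.
  apply: contrapT => no; apply: (uP i); apply: (thinS _ (thin0 N i)) => x [Ax ux].
  by apply: no; exists x.
have [x Ax xu] := pt 0; have [y Ay yu] := pt 1.
by exists x, y; split=> //; rewrite xu yu; exact: umono.
Qed.

Lemma level_noninjective A : positive A -> ~ {in A &, injective level}.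
Proof.
move=> /(positive_fibers small_belowN)[u [_ uP]] inj; apply: (uP 1).
have [[x [Ax ux]]|no] := pselect ((A `&` fiber small_belowN (u 1)) !=set0).
  apply: thinS (thin1 x) => y [Ay uy]; apply: inj; try exact/mem_set.
  by rewrite /level ux uy.
by apply: (thinS _ (thin0 N 1)) => x Ax; apply: no; exists x.
Qed.

(** Apply normal forms to the two-valued function [t] of [A]. If it is constant on [X a], it decides
    [A]; if it determines the level, [A] meets [X a] in a small set, since a positive set has points
    of different levels. *)
#[local] Instance U_ultra : UltraFilter U.
Proof.
apply: (@ultrafilter_dichotomy _ _ U_proper) => A.
pose t n := if pselect (A n) then code 1 else code 0.
have tP n m : t n = t m -> A n -> A m.
  by rewrite /t; case: pselect => // An; case: pselect => // nAm /(can_inj codeK).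
have dich B : (forall x y, B x -> B y -> t x = t y) -> B `<=` A \/ B `<=` ~` A.
  move=> cB; have [BA|nBA] := pselect (B `<=` A); [by left|right].
  move=> x Bx Ax; apply: nBA => y By; exact: tP (cB x y Bx By) Ax.
have [a [cX|iX] _] := U_canonical t.
  by have [sub|sub] := dich _ cX; [left|right]; exact: (filterS sub (in_U a)).
right; exists a; rewrite setDE setCK; apply: contrapT => /positiveP pA.
have [x [y [[Xx Ax] [Xy Ay]]]] := level_nonconstant pA.
by rewrite (iX x y Xx Xy) ?ltnn // /t; do 2!case: pselect.
Qed.

Lemma U_not_singleton n : ~ U [set n].
Proof. by move=> /U_positive /(_ 1); apply; exact: (@thin1 N n). Qed.

Let V : set_system nat := fmap level U.

Lemma V_level_inv A : V A -> positive (level @^-1` A : set N).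
Proof. exact: U_positive. Qed.

Lemma ramsey_V : ramsey V.
Proof.
have uV : UltraFilter V by exact: fmap_ultra.
split=> // [n E|k l c].
  have : V [set n] by rewrite E; exact/principal_filterP.
  move=> /V_level_inv/positiveP; apply; exact: small_fiber.
pose num (s : {fset nat}) : nat := if insub s is Some s' then c s' else 0.
pose t n := code (if choice.unpickle n is Some s then num s else 0).
have numE (s : ksubset k) : color t (val s) = c s.
  by rewrite /color /t choice.pickleK codeK /num valK.
have [a [/= _ _ hom]] := requirementX (k, t).
exists (level @` X a).
  by apply: (filterS _ (in_U a)) => x Xx; exists x.
move=> s s' sH s'H; apply: ord_inj; rewrite -!numE.
apply: (hom l) => //; last 2 first.
- exact/eqP/(valP s).
- exact/eqP/(valP s').
- move=> z /eqP zk; have := numE (exist _ z zk); rewrite /= => ->; exact: ltn_ord.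
Qed.

Lemma V_le_U : RK_le V U. Proof. by exists level. Qed.

(** If [U] is the image of [V] under [f], the points [f (level x)] with [x] in [X a] form a positive
    set. On it [level] would be constant or injective according to the normal form of [g], and
    neither is possible. *)
Lemma U_nle_V : ~ RK_le U V.
Proof.
move=> [f UE]; pose g n := level (f (level n)).
have [a cX _] := U_canonical (code \o g).
have pA : positive ((f \o level) @` X a : set N).
  by apply: U_positive; rewrite UE; apply: (filterS _ (in_U a)) => x Xx; exists x.
case: cX => [cX|iX].
  have [_ [_ [[x Xx <-] [y Xy <-]]]] := level_nonconstant pA.
  have /(can_inj codeK) := cX x y Xx Xy.
  by rewrite /g /= => ->; rewrite ltnn.
apply: (level_noninjective pA) => _ _ /set_mem[x Xx <-] /set_mem[y Xy <-] E.
by rewrite /= (iX x y Xx Xy) //= /g E.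
Qed.

(** The three normal forms make [W] principal, equivalent to [V], or equivalent to [U]. *)
Lemma RK_below_U (W : set_system nat) : UltraFilter W -> nonprincipal W ->
  RK_le W U -> RK_equiv W U \/ RK_equiv W V.
Proof.
move=> uW npW [f WE].
have [a _ [cX|cX|cX]] := U_canonical (code \o f).
- have [x [_ [Xx _ _]]] := level_nonconstant (@positiveX a).
  case: (npW (f x)); apply: principal_of_singleton.
  rewrite WE; apply: (filterS _ (in_U a)) => y Xy /=.
  exact: (can_inj codeK (cX y x Xy Xx)).
- right; rewrite WE; split; apply: (RK_le_factor (Y := X a) _ (in_U a)) => x y Xx Xy E.
    by apply: (can_inj codeK); apply/(cX x y Xx Xy).
  by apply/(cX x y Xx Xy); rewrite /= E.
- left; split; first by exists f.
  rewrite WE -[X in RK_le X _]/(fmap id U).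
  apply: (RK_le_factor (Y := X a) _ (in_U a)) => x y Xx Xy E.
  by apply: cX; rewrite ?inE //= E.
Qed.

(** If the image were longer, omega^omega would embed into one of its proper segments, which are
    small. *)
Lemma small_images_U : small_images (wo_exp omega omega) U.
Proof.
move=> h; have [a [/= _ sX _]] := requirementX (0, h); exists (X a); first exact: in_U.
have [//|[x [f fmono fx]]] := wo_comparable (suborder (h @` X a)) (wo_exp omega omega).
have [k tk] := sX (val x) (set_mem (valP x)).
case: (positive_omega_omega (k := k)).
apply: (thin_preimage (f := val \o f)) tk => [b c _ _ bc|_ [b _ <-]].
  exact: (fmono b c bc).
by split; [exact: (set_mem (valP (f b)))|exact: fx].
Qed.

Variable phi : N -> wo_exp omega omega.
Hypothesis phi_mono : {homo phi : x y / wo_lt x y}.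

Lemma minimal_images_U (beta : wellOrder) :
  small_images beta U -> wo_le (wo_exp omega omega) beta.
Proof.
move=> sb; have [e emono] := omega_omega_omega1.
pose h : nat -> omega1 := e \o phi.
have [Y UY [g [gE _]]] := sb h.
have [//|[x [f fmono fx]]] := wo_comparable (wo_exp omega omega) beta.
have [k tk] := small_below_omega_omega x.
pose inY n := pselect ((h @` Y) (h n)).
(* If [beta] embeds below [x], then [G] maps [Y] increasingly below [x], making [Y] small. The
   default [x] only occurs outside [Y]. *)
pose G (n : N) : wo_exp omega omega :=
  if inY n is left p then f (g (exist _ (h n) (mem_set p))) else x.
have hY n : Y n -> (h @` Y) (h n) by move=> Yn; exists n.
case: (U_positive UY (k := k)); apply: (thin_preimage (f := G)) tk.
  move=> m n /set_mem Ym /set_mem Yn mn; rewrite /G.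
  case: (inY m) => [pm|/(_ (hY m Ym))//]; case: (inY n) => [pn|/(_ (hY n Yn))//].
  apply: fmono; rewrite /wo_lt gE; exact: (emono _ _ (phi_mono mn)).
move=> _ [n Yn <-]; rewrite /G /=; case: (inY n) => [p|/(_ (hY n Yn))//].
exact: fx.
Qed.

Lemma tower_ultrafilter : exists2 U0 : set_system nat,
  ordinal_ultrafilter (wo_exp omega omega) U0 &
  exists V0 : set_system nat,
    [/\ ramsey V0, RK_le V0 U0, ~ RK_equiv V0 U0 &
        forall W : set_system nat,
          UltraFilter W -> nonprincipal W -> RK_le W U0 ->
          RK_equiv W U0 \/ RK_equiv W V0].
Proof.
exists U.
  split.
  - exact: U_ultra.
  - move=> n E; apply: (@U_not_singleton n); rewrite E; exact/principal_filterP.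
  - exact: small_images_U.
  - exact: minimal_images_U.
exists V; split.
- exact: ramsey_V.
- exact: V_le_U.
- by move=> [_ /U_nle_V].
- exact: RK_below_U.
Qed.

End TowerUltrafilter.

Theorem theorem3p3 :
  continuum_hypothesis ->
  exists2 U : set_system nat,
    ordinal_ultrafilter (wo_exp omega omega) U &
    exists V : set_system nat,
      [/\ ramsey V, RK_le V U, ~ RK_equiv V U &
          forall W : set_system nat,
            UltraFilter W -> nonprincipal W -> RK_le W U ->
            RK_equiv W U \/ RK_equiv W V].
Proof.
move=> ch; have [enum enumP] := omega1_coding ch.
have [r [rP [phi phi_mono [psi psi_mono]]]] := nat_omega_omega.
have sN (x : WellOrder rP) : small [set y | wo_lt y x].
  have [k tk] := small_below_omega_omega (phi x); exists k.
  apply: (thin_preimage (f := phi)) tk => [y z _ _|_ [y /= yx <-]]; exact: phi_mono.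
have pN : positive [set: WellOrder rP].
  move=> k tk; apply: (positive_omega_omega (k := k)).
  by apply: (thin_preimage (f := psi)) tk => // y z _ _; exact: psi_mono.
have [e emono] := omega_omega_omega1.
(* Embedding the copy of omega^omega on [nat] into [omega1] also gives the injection by which
   numbers are coded as points of [omega1]. *)
pose code n := e (phi n).
have code_inj : injective code.
  move=> m n E; have [//|lt|lt] := @wo_ltP (WellOrder rP) m n.
  - by have := emono _ _ (phi_mono _ _ lt); rewrite -!/(code _) E wo_ltxx.
  - by have := emono _ _ (phi_mono _ _ lt); rewrite -!/(code _) E wo_ltxx.
have [decode codeK] : exists decode, cancel code decode.
  have /choice[decode decodeP] : forall a, exists n, forall m, code m = a -> m = n.
    move=> a; have [[n na]|no] := pselect (exists n, code n = a).
      by exists n => m; rewrite -na => /code_inj.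
    by exists 0 => m ma; case: no; exists m.
  by exists decode => n; rewrite -(decodeP _ n).
have [X XP] := tower_exists enum sN pN (@requirement_dense r rP sN decode).
apply: (@tower_ultrafilter r rP sN code decode codeK X _ _ _ phi phi_mono).
- by move=> a; have [] := XP a.
- by move=> a b; have [_ _] := XP a; apply.
- by move=> p; have [a ap] := enumP p; exists a; have [_ + _] := XP a; rewrite ap.
Qed.
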